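(* Let $(\Lambda,d)$ be a finitely aligned $k$-graph, and let $\pi$ be a homomorphism of $C^*(\Lambda)$ (into some $C^*$-algebra). Suppose that there is a strongly continuous action $\theta:\mathbb{T}^k\to\operatorname{Aut}\big(C^*(\{\pi(s_\lambda):\lambda\in\Lambda\})\big)$ such that $\theta_z\circ\pi=\pi\circ\gamma_z$ for all $z\in\mathbb{T}^k$. If $\pi(s_v)\neq 0$ for all $v\in\Lambda^0$, then $\pi$ is injective.
   Context: Conventions: $0\in\mathbb{N}$; $\mathbb{N}^k$ is a semigroup with generators $e_1,\dots,e_k$, coordinatewise partial order $\le$, and $m\vee n$ denotes the coordinatewise maximum. A $k$-graph $(\Lambda,d)$ is a countable small category $\Lambda$ with a functor $d:\Lambda\to\mathbb{N}^k$ satisfying the factorisation property: if $d(\lambda)=m+n$ there are unique $\mu,\sigma\in\Lambda$ with $d(\mu)=m$, $d(\sigma)=n$, $\lambda=\mu\sigma$. Morphisms are called paths, objects vertices; $s$ and $r$ are the domain and codomain maps, so $\lambda\mu$ is defined when $s(\lambda)=r(\mu)$. $\Lambda^n:=\{\lambda:d(\lambda)=n\}$, and objects are identified with $\Lambda^0$. For $v\in\Lambda^0$, $v\Lambda:=\{\lambda\in\Lambda:r(\lambda)=v\}$. For $\lambda,\mu\in\Lambda$, $\Lambda^{\min}(\lambda,\mu):=\{(\alpha,\beta):\lambda\alpha=\mu\beta,\ d(\lambda\alpha)=d(\lambda)\vee d(\mu)\}$. $\Lambda$ is finitely aligned if every $\Lambda^{\min}(\lambda,\mu)$ is finite (possibly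 empty). A set $E\subset v\Lambda$ is exhaustive if for every $\mu\in v\Lambda$ there is $\lambda\in E$ with $\Lambda^{\min}(\lambda,\mu)\ne\emptyset$. A Cuntz-Krieger $\Lambda$-family is a collection $\{t_\lambda:\lambda\in\Lambda\}$ of partial isometries in a $C^*$-algebra such that (i) $\{t_v:v\in\Lambda^0\}$ are mutually orthogonal projections; (ii) $t_\lambda t_\mu=t_{\lambda\mu}$ whenever $s(\lambda)=r(\mu)$; (iii) $t_\lambda^*t_\mu=\sum_{(\alpha,\beta)\in\Lambda^{\min}(\lambda,\mu)}t_\alpha t_\beta^*$ for all $\lambda,\mu\in\Lambda$; (iv) $\prod_{\lambda\in E}(t_v-t_\lambda t_\lambda^* )=0$ for all $v\in\Lambda^0$ and all finite exhaustive $E\subset v\Lambda$. $C^*(\Lambda)$ is the universal $C^*$-algebra generated by a Cuntz-Krieger $\Lambda$-family $\{s_\lambda:\lambda\in\Lambda\}$: for each Cuntz-Krieger $\Lambda$-family $\{t_\lambda\}$ there is a unique homomorphism $\pi_t$ of $C^*(\Lambda)$ with $\pi_t(s_\lambda)=t_\lambda$ for all $\lambda$. Homomorphisms are $*$-homomorphisms. The gauge action $\gamma:\mathbb{T}^k\to\operatorname{Aut}(C^*(\Lambda))$ is the strongly continuous action determined by $\gamma_z(s_\lambda)=z^{d(\lambda)}s_\lambda$, where $z^m=z_1^{m_1}\cdots z_k^{m_k}$. *)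

(* Defs.v *)
From HB Require Import structures.
From mathcomp Require Import all_boot all_order all_algebra.
From mathcomp Require Import complex finmap.
From mathcomp Require Import all_classical all_reals all_analysis.

Set Implicit Arguments.
Unset Strict Implicit.
Unset Printing Implicit Defensive.

Import Order.TTheory GRing.Theory Num.Theory.
Import numFieldNormedType.Exports.

Local Open Scope classical_set_scope.
Local Open Scope ring_scope.

(* The cast selects the norm topology on the complex numbers. *)
Notation Cplx R := (complex R : numFieldType).

Reserved Notation "a ** b" (at level 40, left associativity).

(* C*-algebras need not have a unit, so they cannot be built on the ring
   structures of MathComp. The norm of a normed module over [R[i]] takes its
   values in the nonnegative reals of [R[i]]. *)
HB.mixin Record CompleteNormedModule_isCStar (R : realType) A
    of CompleteNormedModule R[i] A := {
  cmul : A -> A -> A;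
  cadj : A -> A;
  cmulA : associative cmul;
  cmulDl : left_distributive cmul +%R;
  cmulDr : right_distributive cmul +%R;
  cmulZl : forall (c : R[i]) (a b : A), cmul (c *: a) b = c *: cmul a b;
  cmulZr : forall (c : R[i]) (a b : A), cmul a (c *: b) = c *: cmul a b;
  cadjK : involutive cadj;
  cadjD : {morph cadj : a b / a + b};
  cadjZ : forall (c : R[i]) (a : A), cadj (c *: a) = c^* *: cadj a;
  cadjM : forall a b : A, cadj (cmul a b) = cmul (cadj b) (cadj a);
  norm_cmul : forall a b : A, `|cmul a b| <= `|a| * `|b|;
  norm_cadj_cmul : forall a : A, `|cmul (cadj a) a| = `|a| ^+ 2
}.

#[short(type="cstarType")]
HB.structure Definition CStar (R : realType) :=
  {A of CompleteNormedModule R[i] A & CompleteNormedModule_isCStar R A}.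

Declare Scope cstar_scope.
Delimit Scope cstar_scope with cstar.
Notation "a ** b" := (cmul a b) : cstar_scope.
Local Open Scope cstar_scope.

Section CStarAlgebras.
Variable R : realType.
Implicit Types A B : cstarType R.

Definition partial_isometry A (a : A) : Prop := a ** cadj a ** a = a.

Definition projection A (a : A) : Prop := cadj a = a /\ a ** a = a.

(* There is no unit to give the product of an empty list its usual value; the
   value 0 below is never used, because exhaustive sets are nonempty. *)
Definition cprod A (s : seq A) : A :=
  if s is a :: s' then foldl cmul a s' else 0.

Record star_subalgebra A (D : set A) : Prop := {
  star_subalgebra0 : D 0;
  star_subalgebra_lin : forall (c : R[i]) a b, D a -> D b -> D (c *: a + b);
  star_subalgebraM : forall a b, D a -> D b -> D (a ** b);
  star_subalgebra_cadj : forall a, D a -> D (cadj a)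
}.

Definition cstar_subalgebra A (D : set A) : Prop :=
  star_subalgebra D /\ closed D.

Definition cstar_generated A (X : set A) : set A :=
  smallest (@cstar_subalgebra A) X.

Record star_hom_on A B (D : set A) (f : A -> B) : Prop := {
  star_hom_lin : forall (c : R[i]) a b, D a -> D b ->
    f (c *: a + b) = c *: f a + f b;
  star_homM : forall a b, D a -> D b -> f (a ** b) = f a ** f b;
  star_hom_cadj : forall a, D a -> f (cadj a) = cadj (f a)
}.

Definition star_hom A B (f : A -> B) : Prop := star_hom_on setT f.

(* An automorphism of a C*-subalgebra [D] of [A] is represented by a function
   on [A] whose values outside [D] are irrelevant. *)
Definition star_aut A (D : set A) (f : A -> A) : Prop :=
  star_hom_on D f /\ set_bij D D f.

End CStarAlgebras.

Section Torus.
Variables (R : realType) (k : nat).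

Definition torus : set 'rV[Cplx R]_k := [set z | forall i, `|z 0 i| = 1].

Definition torus_mul (z w : 'rV[Cplx R]_k) : 'rV[Cplx R]_k :=
  \row_i (z 0 i * w 0 i).

Definition torus_one : 'rV[Cplx R]_k := const_mx 1.

Definition torus_exp (z : 'rV[Cplx R]_k) (m : {ffun 'I_k -> nat}) : R[i] :=
  \prod_i z 0 i ^+ m i.

Record strongly_continuous_action (A : cstarType R) (D : set A)
    (theta : 'rV[Cplx R]_k -> A -> A) : Prop := {
  action_aut : forall z, torus z -> star_aut D (theta z);
  action_one : forall a, D a -> theta torus_one a = a;
  action_mul : forall z w a, torus z -> torus w -> D a ->
    theta (torus_mul z w) a = theta z (theta w a);
  action_cont : forall a, D a ->
    {within torus, continuous (fun z => theta z a)}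
}.

End Torus.

Definition deg_join (k : nat) (m n : {ffun 'I_k -> nat}) :
  {ffun 'I_k -> nat} := [ffun i => maxn (m i) (n i)].

(* Composition is a total function, constrained only on composable pairs;
   [kcomp l m] stands for the composite whose range is the range of [l]. *)
Record kgraph (k : nat) := KGraph {
  path_of :> countType;
  vertex : countType;
  src : path_of -> vertex;
  rng : path_of -> vertex;
  ide : vertex -> path_of;
  kcomp : path_of -> path_of -> path_of;
  deg : path_of -> {ffun 'I_k -> nat};
  src_ide : forall v, src (ide v) = v;
  rng_ide : forall v, rng (ide v) = v;
  src_kcomp : forall l m, src l = rng m -> src (kcomp l m) = src m;
  rng_kcomp : forall l m, src l = rng m -> rng (kcomp l m) = rng l;
  kcomp_idl : forall l, kcomp (ide (rng l)) l = l;
  kcomp_idr : forall l, kcomp l (ide (src l)) = l;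
  kcompA : forall l m n, src l = rng m -> src m = rng n ->
    kcomp l (kcomp m n) = kcomp (kcomp l m) n;
  deg_ide : forall v, deg (ide v) = 0;
  deg_kcomp : forall l m, src l = rng m -> deg (kcomp l m) = deg l + deg m;
  factorisation : forall l m n, deg l = m + n ->
    exists! p : path_of * path_of,
      [/\ deg p.1 = m, deg p.2 = n, src p.1 = rng p.2 & kcomp p.1 p.2 = l]
}.

Section KGraphs.
Variables (k : nat) (L : kgraph k).

Definition Lmin (l m : L) : set (L * L) :=
  [set p | [/\ src l = rng p.1, src m = rng p.2, kcomp l p.1 = kcomp m p.2
             & deg (kcomp l p.1) = deg_join (deg l) (deg m)]].

Definition finitely_aligned : Prop := forall l m : L, finite_set (Lmin l m).

Definition exhaustive (v : vertex L) (E : set L) : Prop :=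
  (forall l, E l -> rng l = v) /\
  (forall m : L, rng m = v -> exists2 l, E l & Lmin l m !=set0).

End KGraphs.

Section CuntzKrieger.
Variables (R : realType) (k : nat) (L : kgraph k).

(* The order of the product over [E] is immaterial: by [CK_min] the range
   projections of a Cuntz-Krieger family commute. *)
Record CK_family (A : cstarType R) (t : L -> A) : Prop := {
  CK_partial_isometry : forall l, partial_isometry (t l);
  CK_projection : forall v, projection (t (ide v));
  CK_orthogonal : forall v w, v <> w -> t (ide v) ** t (ide w) = 0;
  CK_kcomp : forall l m, src l = rng m -> t l ** t m = t (kcomp l m);
  CK_min : forall l m,
    cadj (t l) ** t m = \sum_(p \in Lmin l m) t p.1 ** cadj (t p.2);
  CK_exhaustive : forall v (E : {fset L}), exhaustive v [set` E] ->
    cprod [seq t (ide v) - t l ** cadj (t l) | l <- E] = 0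
}.

(* [A], together with [s], is a copy of the universal C*-algebra of [L]. *)
Record is_graph_algebra (A : cstarType R) (s : L -> A) : Prop := {
  graph_algebra_CK : CK_family s;
  graph_algebra_generated : cstar_generated (range s) = setT;
  graph_algebra_universal : forall (T : cstarType R) (t : L -> T),
    CK_family t ->
    exists! f : A -> T, star_hom f /\ (forall l, f (s l) = t l)
}.

Definition is_gauge_action (A : cstarType R) (s : L -> A)
    (gamma : 'rV[Cplx R]_k -> A -> A) : Prop :=
  strongly_continuous_action setT gamma /\
  (forall z l, torus z -> gamma z (s l) = torus_exp z (deg l) *: s l).

End CuntzKrieger.

(* Main.v *)
(* For [x] in the *-algebra spanned by the [s_l s_m^*], it suffices to bound
   [|x|] by [C |pi x|]: by the C*-identity such a bound for the powers
   [y^(2^j)] of [y = x^* x], with constants [C_j] growing at most like [q^j],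
   improves to [|x| <= |pi x|].

   On the span of the [s_l s_m^*] with [d(l) = d(m)] in a finite join-closed set
   [H] of degrees, the constant is found by induction on [H]. For [d] minimal in
   [H], the terms of degrees [H' = H \ {d}] span an ideal. Either
   [s_l s_l^*] lies in it, or the paths occurring in degrees [H'] are never
   exhaustive at [s(l)], and compressing with [s_l], [s_m] and a path that
   avoids them all bounds the coefficient of [s_l s_m^*] by [|pi x|].

   A general [x] whose terms have degree differences bounded by [K] is the sum
   of [(2K+1)^k] spectral components for the [(2K+1)]-th roots of unity in the
   torus. Averaging with [theta] gives [|pi x_j| <= |pi x|], and [x_j^* x_j]
   has degree zero. The number of components of [y^(2^j)] grows only
   exponentially in [j], so the first remark applies.

   Homomorphisms are contractive (for self-adjoint [a] with [|a| < 1], complete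
   [a] to a unitary [a + i sqrt (1 - a^2)]), so [pi] is isometric everywhere. *)

Require Import Defs.
From mathcomp Require Import all_boot all_order all_algebra.
From mathcomp Require Import cyclic separable cyclotomic.
From mathcomp Require Import complex finmap.
From mathcomp Require Import all_classical all_reals all_analysis.
From mathcomp Require Import lra ring zify.

Set Implicit Arguments.
Unset Strict Implicit.
Unset Printing Implicit Defensive.

Import Order.TTheory GRing.Theory Num.Theory.
Import numFieldNormedType.Exports.

Local Open Scope classical_set_scope.
Local Open Scope ring_scope.
Local Open Scope cstar_scope.

(* MathComp-Analysis uses the name [kcomp] for the composition of kernels. *)
Local Notation kcomp := Defs.kcomp.

(** * Norms in a C*-algebra *)

Section CStarBasics.
Variables (R : realType) (A : cstarType R).
Implicit Types (a b c : A) (z : R[i]).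

Lemma cmul0l a : 0 ** a = 0.
Proof. by apply: (addrI (0 ** a)); rewrite -cmulDl !addr0. Qed.

Lemma cmul0r a : a ** 0 = 0.
Proof. by apply: (addrI (a ** 0)); rewrite -cmulDr !addr0. Qed.

Lemma cmulNl a b : (- a) ** b = - (a ** b).
Proof. by apply: (addrI (a ** b)); rewrite -cmulDl !subrr cmul0l. Qed.

Lemma cmulNr a b : a ** (- b) = - (a ** b).
Proof. by apply: (addrI (a ** b)); rewrite -cmulDr !subrr cmul0r. Qed.

Lemma cmulBl a b c : (a - b) ** c = a ** c - b ** c.
Proof. by rewrite cmulDl cmulNl. Qed.

Lemma cmulBr a b c : a ** (b - c) = a ** b - a ** c.
Proof. by rewrite cmulDr cmulNr. Qed.

Lemma cmul_suml I (r : seq I) (P : pred I) (F : I -> A) a :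
  (\sum_(i <- r | P i) F i) ** a = \sum_(i <- r | P i) F i ** a.
Proof. by apply: (big_morph (cmul^~ a)) => [x y|]; rewrite ?cmulDl ?cmul0l. Qed.

Lemma cmul_sumr I (r : seq I) (P : pred I) (F : I -> A) a :
  a ** (\sum_(i <- r | P i) F i) = \sum_(i <- r | P i) a ** F i.
Proof. by apply: (big_morph (cmul a)) => [x y|]; rewrite ?cmulDr ?cmul0r. Qed.

Lemma cadj0 : cadj (0 : A) = 0.
Proof. by apply: (addrI (cadj (0 : A))); rewrite -cadjD !addr0. Qed.

Lemma cadjN a : cadj (- a) = - cadj a.
Proof. by apply: (addrI (cadj a)); rewrite -cadjD !subrr cadj0. Qed.

(** The norm takes values in [R[i]], which is only partially ordered; its real part lies in the
    ordered field [R] and determines it by [normE]. *)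
Definition nrm a : R := complex.Re `|a|.

Lemma normE a : `|a| = (nrm a)%:C%C.
Proof. by rewrite /nrm RRe_real // ger0_real. Qed.

Lemma nrm_ge0 a : 0 <= nrm a.
Proof. by rewrite -ler0c -normE. Qed.

Lemma nrm0 : nrm 0 = 0.
Proof. by rewrite /nrm normr0. Qed.

Lemma nrm_eq0 a : nrm a = 0 -> a = 0.
Proof. by move=> a0; apply/normr0_eq0; rewrite normE a0. Qed.

Lemma nrmN a : nrm (- a) = nrm a.
Proof. by rewrite /nrm normrN. Qed.

Lemma nrmB_sym a b : nrm (a - b) = nrm (b - a).
Proof. by rewrite -nrmN opprB. Qed.

Lemma nrmD a b : nrm (a + b) <= nrm a + nrm b.
Proof. by rewrite -lecR raddfD/= -!normE ler_normD. Qed.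

Lemma nrmM a b : nrm (a ** b) <= nrm a * nrm b.
Proof. by rewrite -lecR rmorphM/= -!normE norm_cmul. Qed.

Lemma nrmZ z a : nrm (z *: a) = complex.Re `|z| * nrm a.
Proof.
by apply: complexI; rewrite rmorphM/= -!normE normrZ.
Qed.

Lemma nrm_sum I (r : seq I) (P : pred I) (F : I -> A) :
  nrm (\sum_(i <- r | P i) F i) <= \sum_(i <- r | P i) nrm (F i).
Proof.
apply: (big_rec2 (fun x y => nrm x <= y)); first by rewrite nrm0.
by move=> i x y _ xy; apply: (le_trans (nrmD _ _)); rewrite lerD2l.
Qed.

Lemma nrm_cstar a : nrm (cadj a ** a) = nrm a ^+ 2.
Proof. by apply: complexI; rewrite rmorphXn/= -!normE norm_cadj_cmul. Qed.

(** The C*-identity gives [|b|^2 = |cadj b ** b| <= |cadj b| |b|]. Cancelling [|b|] and using this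
    for both [a] and [cadj a] gives equality. *)
Lemma nrm_cadj a : nrm (cadj a) = nrm a.
Proof.
have le b : nrm b <= nrm (cadj b).
  have [->|b0] := eqVneq (nrm b) 0; first exact: nrm_ge0.
  have b_gt0 : 0 < nrm b by rewrite lt_def b0 nrm_ge0.
  by rewrite -(ler_pM2r b_gt0) -expr2 -nrm_cstar nrmM.
by apply/le_anti; rewrite le -{2}(cadjK a) le.
Qed.

Lemma nrm_sqr_sa a : cadj a = a -> nrm (a ** a) = nrm a ^+ 2.
Proof. by move=> aE; rewrite -nrm_cstar aE. Qed.

Lemma closed_nrm (D : set A) :
  (forall a, (forall e : R, 0 < e -> exists2 x, D x & nrm (a - x) < e) -> D a) ->
  closed D.
Proof.
move=> Dcl a; rewrite closureEnbhs /= => aD; apply: Dcl => e e0.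
have e0' : 0 < e%:C%C by rewrite ltcR.
have [x [Dx]] := aD D (ball a e%:C%C) (fun _ H => H) (nbhsx_ballx a _ e0').
by rewrite -ball_normE /= normE ltcR; exists x.
Qed.

Lemma nrm_closed (D : set A) a : closed D ->
  (forall e : R, 0 < e -> exists2 x, D x & nrm (a - x) < e) -> D a.
Proof.
move=> cD h; apply: cD; rewrite /closure /= => B /nbhs_ballP [e /= e0 eB].
have eE : e = (complex.Re e)%:C%C by rewrite RRe_real // gtr0_real.
have [|x Dx ax] := h (complex.Re e); first by rewrite -ltcR -eE.
by exists x; split => //; apply: eB; rewrite -ball_normE /= normE eE ltcR.
Qed.

Lemma nrm_complete (u : nat -> A) :
  (forall e : R, 0 < e -> exists N, forall m n, (N <= m)%N -> (N <= n)%N ->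
     nrm (u m - u n) < e) ->
  exists l, forall e : R, 0 < e ->
    exists N, forall n, (N <= n)%N -> nrm (u n - l) < e.
Proof.
move=> ucauchy.
have /cauchy_cvgP/cvg_ex[l ul] : cauchy (u @ \oo).
  apply/cauchy_ballP => e e0; near_simpl.
  have eE : e = (complex.Re e)%:C%C by rewrite RRe_real // gtr0_real.
  have [|N uN] := ucauchy (complex.Re e); first by rewrite -ltcR -eE.
  exists ([set n | N <= n], [set n | N <= n])%N; first by split; exists N.
  by move=> [m n] [/= mN nN]; rewrite -ball_normE /= normE eE ltcR uN.
exists l => e e0.
have e0' : 0 < e%:C%C by rewrite ltcR.
move/cvgrPdist_lt: ul => /(_ _ e0')[N _ uN]; exists N => n Nn.
by have := uN n Nn; rewrite /= normE ltcR nrmB_sym.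
Qed.

End CStarBasics.

(** * Contractivity of homomorphisms *)

(** If [b < a], the powers [(a / b)^(2^j)] grow doubly exponentially and overtake [C * q^j]. *)
Lemma exp_growth_le (R : realType) (a b C q : R) : 0 <= a -> 0 <= b -> 1 <= q ->
  (forall j, a ^+ (2 ^ j) <= C * q ^+ j * b ^+ (2 ^ j)) -> a <= b.
Proof.
move=> a0 b0 q1 h; rewrite leNgt; apply/negP => ba.
have a_gt0 : 0 < a by exact: le_lt_trans ba.
have {b0} b_gt0 : 0 < b.
  rewrite lt_def b0 andbT; apply/eqP => bE.
  by have := h 0; rewrite bE expn0 !expr1 mulr0 leNgt a_gt0.
have {}h j : (a / b) ^+ (2 ^ j) <= C * q ^+ j.
  by rewrite expr_div_n ler_pdivrMr ?exprn_gt0.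
move: h; set r := a / b => h.
have r1 : 1 < r by rewrite ltr_pdivlMr ?mul1r.
have r1' : 1 <= r by exact: ltW.
have bernoulli n : n%:R * (r - 1) + 1 <= r ^+ n.
  elim: n => [|n ih]; first by rewrite mul0r add0r expr0.
  rewrite exprS; have := ler_wpM2l (ltW (lt_trans ltr01 r1)) ih.
  apply: le_trans; rewrite -natr1 -subr_ge0.
  have -> : r * (n%:R * (r - 1) + 1) - ((n%:R + 1) * (r - 1) + 1)
    = n%:R * (r - 1) ^+ 2 by ring.
  by rewrite mulr_ge0 ?sqr_ge0.
have [i ri] : exists i, 2 * q <= r ^+ (2 ^ i).
  pose x := 2 * q / (r - 1).
  have x0 : 0 <= x by rewrite divr_ge0 ?subr_ge0// mulr_ge0// (le_trans ler01).
  exists (Num.bound x).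
  apply: (@le_trans _ _ (r ^+ Num.bound x)); last first.
    by rewrite ler_weXn2l // ltnW // ltn_expl.
  apply: le_trans (bernoulli _).
  have /ltW := archi_boundP x0.
  by rewrite ler_pdivrMr ?subr_gt0// => /le_trans; apply; rewrite lerDl.
have q0 : 0 < q by rewrite (lt_le_trans ltr01).
(* At index [i + j] the power of [r] is at least [(2q)^(2^j) >= (2q)^j]; cancelling [q^j] bounds all
   powers of 2 by a constant. *)
have big j : 2 ^+ j <= C * q ^+ i.
  have := h (i + j)%N; rewrite expnD exprM exprD mulrA => hj.
  have : (2 * q) ^+ j <= (2 * q) ^+ (2 ^ j).
    by rewrite ler_weXn2l ?(ltnW (ltn_expl _ _))//; lra.
  move=> /le_trans /(_ (_ : _ <= (r ^+ (2 ^ i)) ^+ (2 ^ j))).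
  rewrite lerXn2r ?nnegrE ?mulr_ge0 ?exprn_ge0 //; try lra.
  move=> /(_ isT) /le_trans /(_ hj).
  by rewrite exprMn ler_pM2r ?exprn_gt0.
have C0 : 0 <= C * q ^+ i by apply: le_trans (big 0); rewrite expr0.
have := archi_boundP C0; set n := Num.bound _ => nC.
have := le_lt_trans (big n) nC; rewrite -natrX ltr_nat ltnNge.
by rewrite (ltnW (ltn_expl _ _)).
Qed.

Lemma Re_norm_invn (R : realType) n :
  complex.Re `|(n%:R : R[i])^-1| = n%:R^-1 :> R.
Proof.
rewrite ger0_norm ?invr_ge0 ?ler0n//.
by rewrite -(rmorph_nat (real_complex R)) -fmorphV.
Qed.

Section Contractivity.
Variables (R : realType) (A : cstarType R).
Implicit Types (a b c : A).

Lemma nrm_le_eq a b K : 0 <= K -> (forall e : R, 0 < e -> nrm (a - b) <= K * e) ->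
  a = b.
Proof.
move=> K0 h; apply/subr0_eq/nrm_eq0/le_anti; rewrite nrm_ge0 andbT.
apply/ler_addgt0Pr => e e0; rewrite add0r.
have K1 : 0 < K + 1 by rewrite ltr_wpDl.
have /h /le_trans : 0 < e / (K + 1) by rewrite divr_gt0.
apply; rewrite mulrA ler_pdivrMr // mulrC; apply: ler_wpM2l; first exact: ltW.
by rewrite lerDl.
Qed.

Lemma nrm_sqrB a b : nrm (a ** a - b ** b) <= (nrm a + nrm b) * nrm (a - b).
Proof.
have -> : a ** a - b ** b = a ** (a - b) + (a - b) ** b.
  by rewrite cmulBr cmulBl addrA subrK.
apply: (le_trans (nrmD _ _)); rewrite mulrDl lerD ?nrmM//.
by rewrite mulrC nrmM.
Qed.

(* [c = 1 - sqrt (1 - a^2)], the fixed point of [c |-> (a^2 + c^2) / 2]. *)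
Lemma sqrt_fixpoint (D : set A) a : cstar_subalgebra D -> D a -> cadj a = a ->
  nrm a < 1 -> exists c,
    [/\ D c, cadj c = c, a ** c = c ** a & a ** a + c ** c = c + c].
Proof.
move=> [[D0 Dlin DM Dadj] Dcl] Da aa a1.
pose F c : A := 2^-1 *: (a ** a + c ** c).
have DZ z x : D x -> D (z *: x) by move=> Dx; rewrite -[_ *: _]addr0; exact: Dlin.
have DD x y : D x -> D y -> D (x + y) by move=> ? ?; rewrite -[x]scale1r; exact: Dlin.
have nrmF x : nrm (2^-1 *: x : A) = 2^-1 * nrm x by rewrite nrmZ Re_norm_invn.
pose u n := iter n F 0.
have Du n : D (u n) by elim: n => //= n ih; apply/DZ/DD; exact: DM.
have uu n : cadj (u n) = u n.
  elim: n => [|n ih] /=; first exact: cadj0.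
  by rewrite cadjZ cadjD !cadjM aa ih fmorphV/= conjC_nat.
have au n : a ** u n = u n ** a.
  elim: n => [|n ih] /=; first by rewrite cmul0l cmul0r.
  by rewrite cmulZl cmulZr cmulDl cmulDr !cmulA ih -(cmulA (u n) a) ih cmulA.
have a0 := nrm_ge0 a.
(* The ball of radius [nrm a] is invariant under [F]: [(|a|^2 + |a|^2) / 2 <= |a|] because
   [|a| < 1]. *)
have ua n : nrm (u n) <= nrm a.
  elim: n => [|n ih] /=; first by rewrite nrm0.
  rewrite nrmF mulrC ler_pdivrMr //.
  apply: (le_trans (nrmD _ _)); rewrite mulr_natr mulr2n.
  have := nrmM a a; have := nrmM (u n) (u n); have := nrm_ge0 (u n).
  nra.
(* On that ball [F] contracts by the factor [nrm a], since
   [|F x - F y| <= (|x| + |y|) / 2 * |x - y|]. *)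
have cauchy n p : nrm (u (n + p)%N - u n) <= nrm a ^+ n.
  elim: n => [|n ih]; first by rewrite subr0 expr0 (le_trans (ua p)) ?ltW.
  rewrite addSn /= /F -scalerBr nrmF mulrC ler_pdivrMr // opprD addrACA subrr add0r.
  apply: (le_trans (nrm_sqrB _ _)).
  have := ua (n + p)%N; have := ua n; have := nrm_ge0 (u (n + p)%N - u n).
  rewrite exprS; nra.
have {}cauchy e : 0 < e -> exists N, forall m n, (N <= m)%N -> (N <= n)%N ->
    nrm (u m - u n) < e.
  move=> e0.
  have [N hN] : exists N, nrm a ^+ N < e.
    have /cvgrPdist_lt/(_ _ e0)[N _ hN] : nrm a ^+ n @[n --> \oo] --> 0.
      by apply: cvg_expr; rewrite ger0_norm.
    exists N; have := hN N (leqnn N).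
    by rewrite /= sub0r normrN ger0_norm ?exprn_ge0.
  exists N.
  have H m n : (N <= n)%N -> (n <= m)%N -> nrm (u m - u n) < e.
    move=> Nn nm; rewrite -(subnKC nm); apply: le_lt_trans (cauchy _ _) _.
    by apply: le_lt_trans hN; rewrite ler_wiXn2l // ltW.
  move=> m n Nm Nn; have [nm|mn] := leqP n m; first exact: H.
  by rewrite nrmB_sym H // ltnW.
have [l ul] := nrm_complete cauchy.
have l0 := nrm_ge0 l.
exists l; split.
- apply: nrm_closed => // e e0; have [N hN] := ul e e0.
  by exists (u N) => //; rewrite nrmB_sym hN.
- apply: (@nrm_le_eq _ _ 2) => // e e0; have [N /(_ N (leqnn N)) hN] := ul e e0.
  have -> : cadj l - l = - cadj (u N - l) + (u N - l).
    by rewrite cadjD cadjN uu opprB addrA subrK.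
  apply: (le_trans (nrmD _ _)); rewrite nrmN nrm_cadj; lra.
- apply: (@nrm_le_eq _ _ 2) => // e e0; have [N /(_ N (leqnn N)) hN] := ul e e0.
  have -> : a ** l - l ** a = (u N - l) ** a - a ** (u N - l).
    by rewrite cmulBl cmulBr au opprB [RHS]addrC addrA subrK.
  apply: (le_trans (nrmD _ _)); rewrite nrmN.
  have := nrmM (u N - l) a; have := nrmM a (u N - l); have := nrm_ge0 (u N - l).
  nra.
(* The defect is [2 (u_(N+1) - l) - (u_N^2 - l^2)], of norm at most [2e + (1 + |l|) e]. *)
- apply: (@nrm_le_eq _ _ (3 + nrm l)) => [|e e0]; first lra.
  have [N hN] := ul e e0; have hN1 := hN _ (leqnSn N); have {}hN := hN _ (leqnn N).
  have uS : a ** a + u N ** u N = u N.+1 + u N.+1.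
    rewrite /= -scalerDl -[LHS]scale1r; congr (_ *: _).
    by field.
  have -> : a ** a + l ** l - (l + l) =
     (u N.+1 - l) + (u N.+1 - l) - (u N ** u N - l ** l).
    rewrite addrACA -uS opprB opprD; set X := (X in _ = _ + X + _).
    by rewrite [RHS](AC (2*1*2) (1*4*3*(2*5)))/= subrr addr0.
  apply: (le_trans (nrmD _ _)); rewrite nrmN.
  have := nrmD (u N.+1 - l) (u N.+1 - l); have := nrm_sqrB (u N) l.
  have := ua N; have := nrm_ge0 (u N - l); have := nrm_ge0 (u N).
  nra.
Qed.

End Contractivity.

(* [u = b + eps (1 - d)] and [b - eps (1 - d)] are adjoint to each other and
   their product is 1, so left multiplication by [u] is isometric. *)
Lemma nrm_unitary (R : realType) (A : cstarType R) (b d y : A) (eps : R[i]) :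
  eps^* = - eps -> eps * eps = -1 ->
  cadj b = b -> cadj d = d -> b ** d = d ** b -> b ** b + d ** d = d + d ->
  nrm (b ** y + eps *: (y - d ** y)) = nrm y.
Proof.
move=> epsC eps2 bb dd bd bdE; apply: (@pexpIrn _ 2) => //; rewrite ?nnegrE ?nrm_ge0//.
rewrite -!nrm_cstar; congr nrm; set y' := cadj y.
have E : y' ** (b ** (b ** y)) + y' ** (d ** (d ** y))
    = y' ** (d ** y) + y' ** (d ** y).
  by rewrite -!cmulDr [b ** (b ** y)]cmulA [d ** (d ** y)]cmulA -!cmulDl bdE
     cmulDl !cmulDr.
rewrite cadjD cadjZ epsC cadjD cadjN !cadjM bb dd -/y'.
rewrite cmulDl !cmulDr !cmulZl !cmulZr scalerA mulNr eps2 opprK scale1r.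
rewrite !cmulDl !cmulDr !cmulNl !cmulNr -!cmulA opprK.
rewrite scaleNr -addrA [X in _ + X]addrA -scalerBr [b ** (d ** y)]cmulA bd -cmulA.
rewrite opprD opprK [X in eps *: X]addrACA subrr [- _ + _]addrC subrr addr0 scaler0 add0r.
rewrite [LHS](AC (1*(2*2)) ((1*5)*(3*4)*2))/= E -opprD subrr add0r.
by [].
Qed.

Section StarHom.
Variables (R : realType) (A B : cstarType R) (D : set A) (f : A -> B).
Hypotheses (cD : cstar_subalgebra D) (fD : star_hom_on D f).

Lemma star_homD a b : D a -> D b -> f (a + b) = f a + f b.
Proof. by move=> Da Db; rewrite -[a]scale1r (star_hom_lin fD) // !scale1r. Qed.

Lemma star_hom0 : f 0 = 0.
Proof.
have D0 := star_subalgebra0 cD.1.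
by apply: (addrI (f 0)); rewrite -star_homD // !addr0.
Qed.

Lemma star_homZ z a : D a -> f (z *: a) = z *: f a.
Proof.
move=> Da; have D0 := star_subalgebra0 cD.1.
by rewrite -[z *: a]addr0 (star_hom_lin fD) // star_hom0 addr0.
Qed.

(** With [b = f a] and [d = f c], left multiplications by [b + i(1 - d)] and [b - i(1 - d)] preserve
    norms and add up to that by [2b]. Applying both to [b] gives [2 |b|^2 <= 2 |b|]. *)
Let contractive_sa_lt1 a : D a -> cadj a = a -> nrm a < 1 -> nrm (f a) <= 1.
Proof.
move=> Da aa a1; have [c [Dc cc ac acE]] := sqrt_fixpoint cD Da aa a1.
have DM := star_subalgebraM cD.1.
pose b := f a; pose d := f c.
have bb : cadj b = b by rewrite -(star_hom_cadj fD) // aa.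
have dd : cadj d = d by rewrite -(star_hom_cadj fD) // cc.
have bd : b ** d = d ** b by rewrite -!(star_homM fD) // ac.
have bdE : b ** b + d ** d = d + d.
  by rewrite -!(star_homM fD) // -!star_homD ?acE //; exact: DM.
have iE : ('i : R[i]) * 'i = -1 by rewrite -expr2 sqrCi.
have := @nrm_unitary _ _ b d b 'i (conjCi _) iE bb dd bd bdE.
have := @nrm_unitary _ _ b d b (- 'i) _ _ bb dd bd bdE.
rewrite rmorphN /= conjCi mulrNN => /(_ erefl iE) Em Ep.
have := nrmD (b ** b + 'i *: (b - d ** b)) (b ** b + - 'i *: (b - d ** b)).
rewrite Ep Em addrACA -scalerDl subrr scale0r addr0.
have -> : nrm (b ** b + b ** b) = 2 * nrm b ^+ 2.
  by rewrite -(nrm_sqr_sa bb) -mulr2n -scaler_nat nrmZ ger0_norm ?ler0n.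
have := nrm_ge0 b; rewrite -/b => ? ?; nra.
Qed.

(** The C*-identity reduces to self-adjoint [b]. If [f] increased [|b|], dividing by the midpoint
    [r] of the two norms would bring [b] below norm 1 and leave its image above 1. The domain is a
    subalgebra [D] so that the action [theta] is covered. *)
Lemma star_hom_contractive a : D a -> nrm (f a) <= nrm a.
Proof.
have sa b : D b -> cadj b = b -> nrm (f b) <= nrm b.
  move=> Db bb; rewrite leNgt; apply/negP => lt.
  have fb_gt0 : 0 < nrm (f b) by rewrite (le_lt_trans (nrm_ge0 b)).
  pose r := (nrm b + nrm (f b)) / 2.
  have br : nrm b < r by rewrite midf_lt.
  have rf : r < nrm (f b) by rewrite midf_lt.
  have r0 : 0 < r by rewrite (le_lt_trans (nrm_ge0 b)).
  pose z : R[i] := (r^-1)%:C%C.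
  have zE : complex.Re `|z| = r^-1.
    by rewrite ger0_norm // lecR invr_ge0 ltW.
  have zC : z^* = z by apply/CrealP; rewrite realE lecR invr_ge0 ltW.
  have Dzb : D (z *: b).
    by rewrite -[_ *: _]addr0; apply: (star_subalgebra_lin cD.1) => //; apply: (star_subalgebra0 cD.1).
  have := contractive_sa_lt1 Dzb; rewrite cadjZ zC bb => /(_ erefl).
  rewrite nrmZ star_homZ // nrmZ zE mulrC ltr_pdivrMr // mul1r => /(_ br).
  by rewrite mulrC ler_pdivrMr // mul1r leNgt rf.
move=> Da; rewrite -(@ler_pXn2r _ 2) ?nnegrE ?nrm_ge0// -!nrm_cstar.
have Daa := star_subalgebra_cadj cD.1 Da.
rewrite -(star_hom_cadj fD) // -(star_homM fD) //; apply: sa.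
  exact: (star_subalgebraM cD.1).
by rewrite cadjM cadjK.
Qed.

End StarHom.

Section TotalStarHom.
Variables (R : realType) (A B : cstarType R) (f : A -> B).
Hypothesis fH : star_hom f.

Lemma setT_cstar_subalgebra : cstar_subalgebra (@setT A).
Proof. by split; [split | exact: closedT]. Qed.

Lemma hom_contractive x : nrm (f x) <= nrm x.
Proof. exact: (star_hom_contractive setT_cstar_subalgebra fH). Qed.

Lemma hom0 : f 0 = 0.
Proof. exact: (star_hom0 setT_cstar_subalgebra fH). Qed.

Lemma homD x y : f (x + y) = f x + f y.
Proof. exact: (star_homD fH). Qed.

Lemma homZ c x : f (c *: x) = c *: f x.
Proof. exact: (star_homZ setT_cstar_subalgebra fH). Qed.

Lemma homN x : f (- x) = - f x.
Proof. by rewrite -scaleN1r homZ scaleN1r. Qed.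

End TotalStarHom.

(** * Norm bounds improved by taking powers *)

Section Isometry.
Variables (R : realType) (A B : cstarType R) (f : A -> B).
Hypothesis fH : star_hom f.

(* The C*-identity gives [nrm (y^(2^j)) = nrm y ^ (2^j)] for self-adjoint [y],
   so a bound that loses a factor [C * q^j] on the [j]-th squaring of [y] loses
   nothing on [y]. *)
Lemma nrm_le_of_growth (P : nat -> set A) (C q : R) y : 1 <= q ->
  P 0 y -> cadj y = y -> (forall j x, P j x -> P j.+1 (x ** x)) ->
  (forall j x, P j x -> nrm x <= C * q ^+ j * nrm (f x)) ->
  nrm y <= nrm (f y).
Proof.
move=> q1 P0 yy PM Pf.
pose s j := iter j (fun x : A => x ** x) y.
have Ps j : P j (s j) by elim: j => //= j; exact: PM.
have sa j : cadj (s j) = s j by elim: j => //= j ih; rewrite cadjM ih.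
have fsa j : cadj (f (s j)) = f (s j) by rewrite -(star_hom_cadj fH) // sa.
have ns j : nrm (s j) = nrm y ^+ (2 ^ j).
  elim: j => [|j ih]; first by rewrite expr1.
  by rewrite /= nrm_sqr_sa ?sa // -/(s j) ih expnSr exprM.
have nfs j : nrm (f (s j)) = nrm (f y) ^+ (2 ^ j).
  elim: j => [|j ih]; first by rewrite expr1.
  by rewrite /= (star_homM fH) // nrm_sqr_sa ?fsa // -/(s j) ih expnSr exprM.
apply: (exp_growth_le (nrm_ge0 _) (nrm_ge0 _) q1) => j.
by rewrite -ns -nfs; exact: Pf.
Qed.

Lemma nrm_le_of_cadjM x : nrm (cadj x ** x) <= nrm (f (cadj x ** x)) ->
  nrm x <= nrm (f x).
Proof.
rewrite (star_homM fH) // (star_hom_cadj fH) // !nrm_cstar.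
by rewrite ler_pXn2r ?nnegrE ?nrm_ge0.
Qed.

(** Squaring stays in [X], so one [C] serves every power: this is [nrm_le_of_growth] with
    [q = 1]. *)
Lemma nrm_le_of_bounded (X : set A) (C : R) :
  (forall a b, X a -> X b -> X (a ** b)) -> (forall a, X a -> X (cadj a)) ->
  (forall x, X x -> nrm x <= C * nrm (f x)) ->
  forall x, X x -> nrm x <= nrm (f x).
Proof.
move=> XM Xadj XC x Xx; apply: nrm_le_of_cadjM.
apply: (@nrm_le_of_growth (fun=> X) C 1) => //.
- by apply: XM => //; exact: Xadj.
- by rewrite cadjM cadjK.
- by move=> _ y Xy; exact: XM.
- by move=> j y Xy; rewrite expr1n mulr1; exact: XC.
Qed.

End Isometry.

(** * Linear spans *)

Section LinearSpan.
Variables (R : realType) (A : cstarType R).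
Implicit Types (S T U : set A) (a b : A).

Inductive lspan S : A -> Prop :=
| lspan0 : lspan S 0
| lspan_cons (c : R[i]) a b : S a -> lspan S b -> lspan S (c *: a + b).

Lemma lspan_gen S a : S a -> lspan S a.
Proof.
by move=> Sa; rewrite -[a]scale1r -[_ *: a]addr0; apply: lspan_cons => //; exact: lspan0.
Qed.

Lemma lspanD S a b : lspan S a -> lspan S b -> lspan S (a + b).
Proof.
move=> + Sb; elim => [|c x y Sx _ ih]; first by rewrite add0r.
by rewrite -addrA; exact: lspan_cons.
Qed.

Lemma lspanZ S (c : R[i]) a : lspan S a -> lspan S (c *: a).
Proof.
elim => [|d x y Sx _ ih]; first by rewrite scaler0; exact: lspan0.
by rewrite scalerDr scalerA; exact: lspan_cons.
Qed.

Lemma lspanN S a : lspan S a -> lspan S (- a).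
Proof. by rewrite -scaleN1r; exact: lspanZ. Qed.

Lemma lspanB S a b : lspan S a -> lspan S b -> lspan S (a - b).
Proof. by move=> ? /lspanN; exact: lspanD. Qed.

Lemma lspan_sum S (I : eqType) (r : seq I) (F : I -> A) :
  (forall i, i \in r -> lspan S (F i)) -> lspan S (\sum_(i <- r) F i).
Proof.
move=> SF; rewrite big_seq; elim/big_rec: _ => [|i x ir Sx]; first exact: lspan0.
by apply: lspanD => //; exact: SF.
Qed.

Lemma lspan_sub S T : (forall a, S a -> lspan T a) ->
  forall a, lspan S a -> lspan T a.
Proof.
move=> ST a; elim => [|c x y Sx _ ih]; first exact: lspan0.
by apply: lspanD => //; apply/lspanZ/ST.
Qed.

Lemma lspanM S T U : (forall a b, S a -> T b -> lspan U (a ** b)) ->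
  forall a b, lspan S a -> lspan T b -> lspan U (a ** b).
Proof.
move=> STU a b Sa Tb; elim: Sa => [|c x y Sx _ ih].
  by rewrite cmul0l; exact: lspan0.
rewrite cmulDl cmulZl; apply: lspanD => //; apply: lspanZ.
elim: Tb => [|d x' y' Tx _ ih']; first by rewrite cmul0r; exact: lspan0.
by rewrite cmulDr cmulZr; apply: lspanD => //; apply/lspanZ/STU.
Qed.

Lemma lspan_cadj S T : (forall a, S a -> lspan T (cadj a)) ->
  forall a, lspan S a -> lspan T (cadj a).
Proof.
move=> ST a; elim => [|c x y Sx _ ih]; first by rewrite cadj0; exact: lspan0.
by rewrite cadjD cadjZ; apply: lspanD => //; apply/lspanZ/ST.
Qed.

End LinearSpan.

(** * Minimal common extensions of paths of equal degree *)

Section KGraphFacts.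
Variables (k : nat) (L : kgraph k).
Implicit Types l m : L.

(** [l] factors with degrees [0 + 0] both as [ide (rng l)] followed by [l] and as [l] followed by
    [ide (src l)]; the factorisation is unique. *)
Lemma deg_eq0 l : deg l = 0 -> l = ide (src l).
Proof.
move=> l0; have [|p [_ uniq_p]] := @factorisation _ L l 0 0; first by rewrite addr0.
suff [] : (ide (rng l), l) = (l, ide (src l)) by [].
transitivity p; [symmetry|]; apply: uniq_p; split => //=;
  by rewrite ?l0 ?deg_ide ?src_ide ?rng_ide ?kcomp_idl ?kcomp_idr.
Qed.

Lemma deg_addr_id (a b : {ffun 'I_k -> nat}) : a + b = a -> b = 0.
Proof.
move=> /ffunP ab; apply/ffunP => i; have := ab i; rewrite !ffunE.
by move=> /eqP; rewrite -[X in _ == X]addn0 eqn_add2l => /eqP.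
Qed.

Lemma deg_joinC (a b : {ffun 'I_k -> nat}) : deg_join a b = deg_join b a.
Proof. by apply/ffunP => i; rewrite !ffunE maxnC. Qed.

Lemma deg_joinxx (a : {ffun 'I_k -> nat}) : deg_join a a = a.
Proof. by apply/ffunP => i; rewrite !ffunE maxnn. Qed.

(** The join of the degrees is [deg l] itself, so both extending paths have degree 0 and are
    identities. *)
Lemma Lmin_same_deg l m p : deg l = deg m -> Lmin l m p ->
  l = m /\ p = (ide (src l), ide (src l)).
Proof.
have tail0 (x y : L) : src x = rng y -> deg (kcomp x y) = deg x -> y = ide (src x).
  move=> xy; rewrite deg_kcomp // => /deg_addr_id /deg_eq0 yE.
  by rewrite xy yE rng_ide.
case: p => a b lm [/= la mb lamb]; rewrite -lm deg_joinxx => dla.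
have aE := tail0 _ _ la dla; have bE : b = ide (src m).
  by apply: tail0 => //; rewrite -lamb dla.
have lmE : l = m by rewrite -(kcomp_idr l) -(kcomp_idr m) -aE -bE.
by rewrite aE bE lmE.
Qed.

Lemma Lmin_diag l : Lmin l l = [set (ide (src l), ide (src l))].
Proof.
apply/seteqP; split => p; first by case/(Lmin_same_deg erefl).
by move=> ->; split => /=; rewrite ?rng_ide // kcomp_idr deg_joinxx.
Qed.

Lemma Lmin_empty l m : deg l = deg m -> l <> m -> Lmin l m = set0.
Proof.
by move=> dlm lm; rewrite -subset0 => p /(Lmin_same_deg dlm)[].
Qed.

End KGraphFacts.

(** * Cuntz-Krieger families *)

Section CuntzKriegerFacts.
Variables (R : realType) (k : nat) (L : kgraph k) (A : cstarType R) (t : L -> A).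
Hypotheses (L_fa : finitely_aligned L) (tCK : CK_family t).
Implicit Types l m : L.

Lemma CK_adj_mul l m :
  cadj (t l) ** t m = \sum_(p <- fset_set (Lmin l m)) t p.1 ** cadj (t p.2).
Proof. by rewrite (CK_min tCK) fsbig_finite. Qed.

Lemma CK_src l : t l ** t (ide (src l)) = t l.
Proof. by rewrite (CK_kcomp tCK) ?rng_ide // kcomp_idr. Qed.

Lemma CK_rng l : t (ide (rng l)) ** t l = t l.
Proof. by rewrite (CK_kcomp tCK) ?src_ide // kcomp_idl. Qed.

Lemma CK_adj_self l : cadj (t l) ** t l = t (ide (src l)).
Proof.
rewrite CK_adj_mul Lmin_diag fset_set1 big_seq_fset1 /=.
by case: (CK_projection tCK (src l)) => -> ->.
Qed.

Lemma CK_adj_Lmin0 l m : Lmin l m = set0 -> cadj (t l) ** t m = 0.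
Proof. by move=> lm; rewrite CK_adj_mul lm fset_set0 big_seq_fset0. Qed.

Lemma CK_adj_same_deg l m : deg l = deg m -> l <> m -> cadj (t l) ** t m = 0.
Proof. by move=> dlm lm; apply: CK_adj_Lmin0; exact: Lmin_empty. Qed.

Lemma nrm_projection (p : A) : projection p -> p <> 0 -> nrm p = 1.
Proof.
move=> [pp p2] p0; have := nrm_sqr_sa pp; rewrite p2 expr2 => /esym pE.
apply: (@mulfI _ (nrm p)); last by rewrite pE mulr1.
by apply/eqP => /nrm_eq0.
Qed.

Lemma nrm_CK_le1 l : nrm (t l) <= 1.
Proof.
rewrite -(@ler_pXn2r _ 2) ?nnegrE ?nrm_ge0// -nrm_cstar CK_adj_self expr1n.
have [->|/eqP p0] := eqVneq (t (ide (src l))) 0; first by rewrite nrm0.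
by rewrite (nrm_projection (CK_projection tCK _) p0).
Qed.

(** The relation [Q] on pairs of degrees lets one definition serve the full span, the core, its
    finite pieces, the bands and the residue classes. *)
Definition ckgen (Q : {ffun 'I_k -> nat} -> {ffun 'I_k -> nat} -> Prop) : set A :=
  [set a | exists l m,
     [/\ src l = src m, Q (deg l) (deg m) & a = t l ** cadj (t m)]].

Definition ckspan Q : set A := lspan (ckgen Q).

Lemma ckspan_gen (Q : {ffun 'I_k -> nat} -> {ffun 'I_k -> nat} -> Prop) l m :
  src l = src m -> Q (deg l) (deg m) -> ckspan Q (t l ** cadj (t m)).
Proof. by move=> lm Qlm; apply: lspan_gen; exists l, m. Qed.

Lemma ckspan_sub (P Q : {ffun 'I_k -> nat} -> {ffun 'I_k -> nat} -> Prop) :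
  (forall a b, P a b -> Q a b) -> ckspan P `<=` ckspan Q.
Proof.
move=> PQ; apply: lspan_sub => _ [l [m [lm Plm ->]]].
by apply: ckspan_gen => //; exact: PQ.
Qed.

Lemma ckspan_cadj (P Q : {ffun 'I_k -> nat} -> {ffun 'I_k -> nat} -> Prop) :
  (forall a b, P a b -> Q b a) -> forall x, ckspan P x -> ckspan Q (cadj x).
Proof.
move=> PQ; apply: lspan_cadj => _ [l [m [lm Plm ->]]].
by rewrite cadjM cadjK; apply: ckspan_gen => //; exact: PQ.
Qed.

(* Degrees of the terms of [t l t_m^* t_n t_p^*], where [b] and [c] are the
   degrees of [m] and [n]: a pair in [Lmin m n] has degrees [(x, y)] with
   [b + x = c + y = deg_join b c]. *)
Lemma ckspanM (P Q U : {ffun 'I_k -> nat} -> {ffun 'I_k -> nat} -> Prop) :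
  (forall a b c d x y, P a b -> Q c d -> b + x = deg_join b c ->
     c + y = deg_join b c -> U (a + x) (d + y)) ->
  forall a b, ckspan P a -> ckspan Q b -> ckspan U (a ** b).
Proof.
move=> PQU; apply: lspanM => _ _ [l [m [lm Plm ->]]] [n [p [np Qnp ->]]].
rewrite -cmulA [cadj (t m) ** _]cmulA CK_adj_mul cmul_suml cmul_sumr.
apply: lspan_sum => -[x y]; rewrite in_fset_set // inE => -[/= mx ny mxny dmx].
have lx : src l = rng x by rewrite lm.
have py : src p = rng y by rewrite -np.
rewrite -cmulA -cadjM cmulA !(CK_kcomp tCK) //.
apply: ckspan_gen; first by rewrite !src_kcomp // -(src_kcomp mx) mxny src_kcomp.
rewrite !deg_kcomp //; apply: (PQU _ _ _ _ _ _ Plm Qnp).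
  by rewrite -deg_kcomp.
by rewrite -deg_kcomp // -mxny.
Qed.

End CuntzKriegerFacts.

(** * Isometry on the core *)

Section Core.
Variables (R : realType) (k : nat) (L : kgraph k) (A B : cstarType R).
Variables (s : L -> A) (pi : A -> B).
Hypotheses (L_fa : finitely_aligned L) (sCK : CK_family s) (pi_hom : star_hom pi).
Hypothesis pi_vertex : forall v : vertex L, pi (s (ide v)) <> 0.
Implicit Types (l m : L) (H : seq {ffun 'I_k -> nat}).

(** The assumption on vertices enters here: a nonzero projection has norm 1. *)
Lemma nrm_pi_vertex v : nrm (pi (s (ide v))) = 1.
Proof.
apply: nrm_projection => //; have [p1 p2] := CK_projection sCK v; split.
  by rewrite -(star_hom_cadj pi_hom) // p1.
by rewrite -(star_homM pi_hom) // p2.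
Qed.

Lemma nrm_pi_compress a x b : nrm a <= 1 -> nrm b <= 1 ->
  nrm (pi (a ** x ** b)) <= nrm (pi x).
Proof.
move=> a1 b1; rewrite !(star_homM pi_hom) //.
have := nrmM (pi a ** pi x) (pi b); have := nrmM (pi a) (pi x).
have := hom_contractive pi_hom a; have := hom_contractive pi_hom b.
have := nrm_ge0 (pi a); have := nrm_ge0 (pi b); have := nrm_ge0 (pi x).
have := nrm_ge0 (pi a ** pi x); nra.
Qed.

Definition diagonal H (a b : {ffun 'I_k -> nat}) : Prop := a = b /\ a \in H.

Definition join_closed H : Prop :=
  forall a b, a \in H -> b \in H -> deg_join a b \in H.

Section MinimalDegree.
Variables (H : seq {ffun 'I_k -> nat}) (d : {ffun 'I_k -> nat}).
Hypotheses (Hjoin : join_closed H) (dH : d \in H).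
Hypothesis d_min : forall n, n \in H -> deg_join d n = d -> n = d.
Let H' := [seq n <- H | n != d].

(** If the join of [n] and [p] were [d], then [p] would lie below [d], so [p = d] by minimality. *)
Let join_H' n p : n \in H -> p \in H' -> deg_join n p \in H'.
Proof.
rewrite !mem_filter => nH /andP[pd pH]; rewrite Hjoin // andbT.
apply: contra pd => /eqP np; apply/eqP; apply: d_min => //; apply/ffunP => i.
by move/ffunP: np => /(_ i); rewrite !ffunE => <-; rewrite -maxnA maxnn.
Qed.

Let H'_sub n : n \in H' -> n \in H. Proof. by rewrite mem_filter => /andP[]. Qed.

Let join_H'_l n p : n \in H' -> p \in H -> deg_join n p \in H'.
Proof. by rewrite deg_joinC => nH' pH; exact: join_H'. Qed.

Lemma join_closed_H' : join_closed H'.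
Proof. by move=> a b aH' bH'; apply: join_H'_l => //; exact: H'_sub. Qed.

(** A product of diagonal terms of degrees [a] and [c] has terms of degree [deg_join a c] only, and
    [H'] absorbs joins with [H]. *)
Lemma ideal_r a b : ckspan s (diagonal H') a -> ckspan s (diagonal H) b ->
  ckspan s (diagonal H') (a ** b).
Proof.
apply: (ckspanM L_fa sCK) => {}a {}b c e x y [<- aH'] [<- cH] ax cy.
by rewrite ax cy; split=> //; exact: join_H'_l.
Qed.

Lemma ideal_l a b : ckspan s (diagonal H) a -> ckspan s (diagonal H') b ->
  ckspan s (diagonal H') (a ** b).
Proof.
apply: (ckspanM L_fa sCK) => {}a {}b c e x y [<- aH] [<- cH'] ax cy.
by rewrite ax cy; split=> //; exact: join_H'.
Qed.

Lemma ideal_cadj a : ckspan s (diagonal H') a -> ckspan s (diagonal H') (cadj a).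
Proof. by apply: (ckspan_cadj) => a' b' [<-]. Qed.

Lemma ideal_sub a : ckspan s (diagonal H') a -> ckspan s (diagonal H) a.
Proof. by apply: ckspan_sub => a' b' [<- /H'_sub]. Qed.

(* [prod (s v - s a ** cadj (s a)) = 0], conjugated by [s l] and expanded. *)
Lemma exhaustive_absorbed l (E : {fset L}) : deg l = d ->
  exhaustive (src l) [set` E] ->
  (forall a, a \in E -> deg (kcomp l a) \in H') ->
  ckspan s (diagonal H') (s l ** cadj (s l)).
Proof.
move=> dl [Ev Eex] EH'.
have := CK_exhaustive sCK (conj Ev Eex).
set v := src l in Ev Eex *.
have [vv v2] := CK_projection sCK v.
have gen a : a \in E ->
    ckspan s (diagonal H') (s l ** (s a ** cadj (s a)) ** cadj (s l)).
  move=> aE; have la : src l = rng a by rewrite (Ev a).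
  rewrite -!cmulA -cadjM cmulA !(CK_kcomp sCK) //.
  by apply: ckspan_gen => //; split=> //; exact: EH'.
have qv a : a \in E -> (s a ** cadj (s a)) ** s (ide v) = s a ** cadj (s a).
  move=> aE; rewrite -cmulA; congr (_ ** _).
  by rewrite -[RHS](congr1 cadj (CK_rng sCK a)) // cadjM (Ev a) // vv.
have vq a : a \in E -> s (ide v) ** (s a ** cadj (s a)) = s a ** cadj (s a).
  by move=> aE; rewrite cmulA -{1}(Ev a aE) (CK_rng sCK).
(* Conjugation by [s l] is multiplicative because [cadj (s l) ** s l] is the projection at [v]. *)
have conj_mul X Y : X ** s (ide v) = X ->
    (s l ** (X ** Y)) ** cadj (s l) =
    (s l ** X ** cadj (s l)) ** (s l ** Y ** cadj (s l)).
  move=> Xv; rewrite -!cmulA [cadj (s l) ** (s l ** _)]cmulA (CK_adj_self L_fa sCK).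
  by rewrite [X ** (s (ide _) ** _)]cmulA Xv.
(* Invariant of the fold: for the partial product [P], the conjugate of [s (ide v) - P] by [s l]
   lies in the ideal. Once the product is 0, this conjugate is [s l ** cadj (s l)]. *)
have step r P : {subset r <= E} -> P ** s (ide v) = P ->
    ckspan s (diagonal H') (s l ** (s (ide v) - P) ** cadj (s l)) ->
    foldl cmul P [seq s (ide v) - s a ** cadj (s a) | a <- r] = 0 ->
    ckspan s (diagonal H') (s l ** cadj (s l)).
  elim: r P => [|a r ih] P rE Pv Pspan /=.
    by move=> P0; move: Pspan; rewrite P0 subr0 (CK_src sCK).
  have aE : a \in E by apply: rE; rewrite mem_head.
  apply: ih => [x xr||]; first by apply: rE; rewrite in_cons xr orbT.
    by rewrite cmulBr Pv cmulBl Pv -cmulA qv.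
  have -> : s (ide v) - P ** (s (ide v) - s a ** cadj (s a)) =
      s (ide v) - P + P ** (s a ** cadj (s a)).
    by rewrite cmulBr Pv opprB addrA addrAC.
  rewrite cmulDr cmulDl; apply: lspanD => //.
  have -> : s l ** (P ** (s a ** cadj (s a))) ** cadj (s l) =
     s l ** (s a ** cadj (s a)) ** cadj (s l) -
     (s l ** (s (ide v) - P) ** cadj (s l)) **
       (s l ** (s a ** cadj (s a)) ** cadj (s l)).
    rewrite -conj_mul; last by rewrite cmulBl v2 Pv.
    by rewrite cmulBl vq // cmulBr cmulBl subKr.
  by apply: lspanB; [exact: gen|apply: ideal_r => //; apply/ideal_sub/gen].
(* An exhaustive set meets the vertex path, so [E] is nonempty; on an empty list [cprod] is 0 by
   convention and its vanishing says nothing. *)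
have [a aE _] : exists2 a, a \in E & Lmin a (ide v) !=set0.
  by have [a] := Eex (ide v) (rng_ide _); exists a.
have : a \in enum_fset E by [].
have sub : {subset enum_fset E <= E} by [].
move: sub; case: (enum_fset E) => // b r rE _ /=.
have bE : b \in E by apply: rE; rewrite mem_head.
apply: step => [x xr||]; first by apply: rE; rewrite in_cons xr orbT.
  by rewrite cmulBl v2 qv.
by rewrite subKr; exact: gen.
Qed.

Section Leading.
Variable G : seq L.
Hypothesis G_uniq : uniq G.
Hypothesis G_deg : forall l, l \in G -> deg l = d.

(** Since the paths of [G] share the degree [d], these elements multiply like matrix units indexed
    by pairs with a common source. *)
Definition leading_gen : set A :=
  [set a | exists l m, [/\ l \in G, m \in G, src l = src m & a = s l ** cadj (s m)]].

Let X := lspan (leading_gen `|` ckgen s (diagonal H')).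

Let X_diag a : X a -> ckspan s (diagonal H) a.
Proof.
apply: lspan_sub => {}a [[l [m [lG mG lm ->]]]|aH']; last first.
  by apply: ideal_sub; exact: lspan_gen.
by apply: ckspan_gen => //; rewrite !G_deg.
Qed.

Let H'_X a : ckspan s (diagonal H') a -> X a.
Proof. by apply: lspan_sub => {}a aH'; apply: lspan_gen; right. Qed.

Let X_mul a b : X a -> X b -> X (a ** b).
Proof.
apply: lspanM => {}a {}b Sa Sb.
have Xa := X_diag (lspan_gen Sa); have Xb := X_diag (lspan_gen Sb).
case: Sa => [[l [m [lG mG lm ->]]]|aH'] in Xa *; last first.
  by apply: H'_X; apply: ideal_r => //; exact: lspan_gen.
case: Sb => [[n [p [nG pG np ->]]]|bH'] in Xb *; last first.
  by apply: H'_X; apply: ideal_l => //; exact: lspan_gen.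
rewrite -cmulA [cadj (s m) ** _]cmulA.
have [mn|/eqP mn] := eqVneq m n; last first.
  rewrite (CK_adj_same_deg L_fa sCK _ mn) ?G_deg // cmul0l cmul0r.
  exact: lspan0.
subst n; rewrite (CK_adj_self L_fa sCK) -lm cmulA (CK_src sCK).
by apply: lspan_gen; left; exists l, p; split => //; rewrite lm.
Qed.

Let X_cadj a : X a -> X (cadj a).
Proof.
apply: lspan_cadj => {}a [[l [m [lG mG lm ->]]]|aH'].
  by rewrite cadjM cadjK; apply: lspan_gen; left; exists m, l.
by apply/H'_X/ideal_cadj/lspan_gen.
Qed.

Let X_decomp a : X a -> exists (c : L -> L -> R[i]) a',
  ckspan s (diagonal H') a' /\
  a = \sum_(l <- G) \sum_(m <- G | src l == src m) c l m *: (s l ** cadj (s m)) + a'.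
Proof.
elim => [|e {}a b Sa _ [c [b' [b'H' bE]]]].
  exists (fun _ _ => 0), 0; split; first exact: lspan0.
  by rewrite addr0 big1 // => l _; rewrite big1 // => m _; rewrite scale0r.
case: Sa => [[l0 [m0 [lG mG lm ->]]]|aH']; last first.
  exists c, (e *: a + b'); split; last by rewrite bE addrCA.
  by apply: lspanD => //; apply/lspanZ/lspan_gen.
exists (fun l m => (if (l == l0) && (m == m0) then e else 0) + c l m), b'.
split=> //; rewrite bE addrA; congr (_ + _).
under [RHS]eq_bigr do under eq_bigr do rewrite scalerDl.
under [RHS]eq_bigr do rewrite big_split.
rewrite big_split /=; congr (_ + _).
rewrite (bigD1_seq l0) //= [X in _ + X]big1 => [|l /negPf ->]; last first.
  by rewrite big1 // => m _; rewrite scale0r.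
rewrite addr0 big_mkcond (bigD1_seq m0) //= lm !eqxx [X in _ + X]big1 ?addr0 //.
by move=> m /negPf ->; rewrite scale0r if_same.
Qed.

(** For each term [s n ** cadj (s p)] of [a], the product [cadj (s l0) ** s n] is a sum of
    [s x ** cadj (s y)] over [Lmin l0 n]. The finitely many [x] form [E], and a path [m] orthogonal
    to all of them kills the compression. *)
Let remainder_tail l0 m0 a : l0 \in G -> m0 \in G -> ckspan s (diagonal H') a ->
  exists E : seq L, (forall x, x \in E -> src l0 = rng x /\ deg (kcomp l0 x) \in H') /\
    forall m, (forall x, x \in E -> cadj (s m) ** s x = 0) ->
      cadj (s m) ** (cadj (s l0) ** a ** s m0) = 0.
Proof.
move=> lG mG; elim => [|c {}a b [n [p [np [dnp nH'] ->]]] _ [E [EH' Eb]]].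
  by exists [::]; split=> // m _; rewrite cmul0r cmul0l cmul0r.
exists ([seq x.1 | x <- fset_set (Lmin l0 n)] ++ E); split => [x|m mE].
  rewrite mem_cat => /orP[/mapP[[x' y]]|/EH'//].
  rewrite in_fset_set // inE => -[/= lx ny _ dx] ->; split=> //.
  by rewrite dx G_deg //; apply: join_H' => //.
rewrite cmulDr cmulDl cmulDr Eb ?addr0; last first.
  by move=> x xE; apply: mE; rewrite mem_cat xE orbT.
rewrite cmulZr cmulZl cmulZr [cadj (s l0) ** _]cmulA (CK_adj_mul L_fa sCK).
rewrite !cmul_suml cmul_sumr big_seq big1 ?scaler0 // => -[x y] xy.
rewrite -!cmulA cmulA mE ?cmul0l // mem_cat.
by apply/orP; left; apply/mapP; exists (x, y).
Qed.

Hypothesis G_good : forall l, l \in G ->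
  ~ ckspan s (diagonal H') (s l ** cadj (s l)).

(** By [exhaustive_absorbed] and [G_good], the set [E] of the remainder is not exhaustive, so some
    [m] has no common extension with its paths. Compressing by [s l0], [s m0] and then [s m] leaves
    [c l0 m0] times a vertex projection, whose image has norm 1. *)
Let coef_le (c : L -> L -> R[i]) a' l0 m0 : ckspan s (diagonal H') a' ->
  l0 \in G -> m0 \in G -> src l0 = src m0 ->
  complex.Re `|c l0 m0| <= nrm (pi
    (\sum_(l <- G) \sum_(m <- G | src l == src m) c l m *: (s l ** cadj (s m)) + a')).
Proof.
move=> a'H' lG mG lm.
have [E [EH' Ea']] := remainder_tail lG mG a'H'.
have [m [mv mE]] : exists m, rng m = src l0 /\
    forall x, x \in E -> cadj (s m) ** s x = 0.
  apply: contrapT => nm; apply: (G_good lG).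
  apply: (@exhaustive_absorbed _ [fset x in E]%fset); first exact: G_deg.
    split => [x|m mv].
      by rewrite /= inE /= => /EH'[].
    apply: contrapT => mE; apply: nm; exists m; split=> // x xE.
    rewrite -[LHS]cadjK cadjM cadjK (CK_adj_Lmin0 L_fa sCK) ?cadj0 //.
    apply/eqP/negPn/negP => /set0P xm; apply: mE; exists x => //=.
    by rewrite inE.
  by move=> x; rewrite inE => /EH'[].
set x := _ + a'.
have gE l n : l \in G -> n \in G ->
    cadj (s l0) ** (s l ** cadj (s n)) ** s m0 =
    if (l == l0) && (n == m0) then s (ide (src l0)) else 0.
  move=> l_G n_G; rewrite -!cmulA.
  have [->|/eqP nm] := eqVneq n m0; last first.
    by rewrite (CK_adj_same_deg L_fa sCK _ nm) ?G_deg // !cmul0r andbF.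
  rewrite andbT (CK_adj_self L_fa sCK) cmulA.
  have [->|/eqP ll] := eqVneq l l0.
    by rewrite (CK_adj_self L_fa sCK) -lm; case: (CK_projection sCK (src l0)).
  by rewrite (CK_adj_same_deg L_fa sCK) ?cmul0l ?G_deg // => /esym.
have xE : cadj (s m) ** (cadj (s l0) ** x ** s m0) ** s m = c l0 m0 *: s (ide (src m)).
  have -> : c l0 m0 *: s (ide (src m)) =
      cadj (s m) ** (c l0 m0 *: s (ide (src l0))) ** s m.
    by rewrite cmulZr cmulZl -cmulA -mv (CK_rng sCK) (CK_adj_self L_fa sCK).
  congr (_ ** _).
  rewrite cmulDr cmulDl cmulDr Ea' // addr0; congr (_ ** _).
  rewrite cmul_sumr cmul_suml (bigD1_seq l0) //= [X in _ + X]big_seq_cond.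
  rewrite [X in _ + X]big1 => [|l /andP[l_G /negPf ll]]; last first.
    rewrite cmul_sumr cmul_suml big_seq_cond big1 // => n /andP[n_G _].
    by rewrite cmulZr cmulZl gE // ll scaler0.
  rewrite addr0 cmul_sumr cmul_suml big_mkcond (bigD1_seq m0) //= lm eqxx.
  rewrite cmulZr cmulZl gE // !eqxx lm.
  rewrite big_seq_cond big1 ?addr0 // => n /andP[n_G /negPf nm].
  by rewrite cmulZr cmulZl gE // nm andbF scaler0 if_same.
have : nrm (pi (cadj (s m) ** (cadj (s l0) ** x ** s m0) ** s m)) <= nrm (pi x).
  by apply: le_trans (nrm_pi_compress _ _ _) (nrm_pi_compress _ _ _);
    rewrite ?nrm_cadj; exact: nrm_CK_le1.
by rewrite xE (homZ pi_hom) nrmZ nrm_pi_vertex mulr1.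
Qed.

Hypothesis IH : forall x, ckspan s (diagonal H') x -> nrm x <= nrm (pi x).

Lemma core_step a : X a -> nrm a <= nrm (pi a).
Proof.
(* For [a = y + a'], the bound on [a'] gives [|a'| <= |pi a| + |pi y| <= |pi a| + |y|], so
   [|a| <= |pi a| + 2 |y|]; the at most [(size G)^2] coefficients of [y] are each bounded by
   [|pi a|]. *)
apply: (nrm_le_of_bounded pi_hom X_mul X_cadj (C := 1 + 2 * (size G)%:R ^+ 2)).
move=> {}a /X_decomp[c [a' [a'H' aE]]].
set y := \sum_(l <- G) _ in aE.
have y_le : nrm y <= (size G)%:R ^+ 2 * nrm (pi a).
  have const (b : R) (r : seq L) : \sum_(l <- r) b = (size r)%:R * b.
    by rewrite big_const_seq count_predT iter_addr_0 mulr_natl.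
  apply: (le_trans (nrm_sum _ _ _)); rewrite expr2 -mulrA -const big_seq [leRHS]big_seq.
  apply: ler_sum => l lG; apply: (le_trans (nrm_sum _ _ _)).
  rewrite -const big_seq_cond [leRHS]big_seq_cond big_mkcond [leRHS]big_mkcond /=.
  apply: ler_sum => m _; rewrite andbT; case: ifP => [/andP[mG /eqP lm]|]; last first.
    by case: ifP => // _ _; exact: nrm_ge0.
  rewrite mG nrmZ; apply: (@le_trans _ _ (complex.Re `|c l m|)).
    have : nrm (s l ** cadj (s m)) <= 1.
      apply: (le_trans (nrmM _ _)); rewrite nrm_cadj.
      have := nrm_CK_le1 L_fa sCK l; have := nrm_CK_le1 L_fa sCK m.
      have := nrm_ge0 (s l); have := nrm_ge0 (s m); nra.
    have : 0 <= complex.Re `|c l m| by rewrite -ler0c RRe_real ?ger0_real.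
    nra.
  by rewrite aE; exact: coef_le.
have a_le : nrm a <= nrm y + nrm a' by rewrite aE nrmD.
have pia' : pi a' = pi a - pi y by rewrite aE (homD pi_hom) addrAC subrr add0r.
have := IH a'H'; rewrite pia' => a'_le.
have := nrmD (pi a) (- pi y); rewrite nrmN => a'_le2.
have := hom_contractive pi_hom y; nra.
Qed.

End Leading.

(** [G] keeps the paths whose range projections lie outside the ideal. As
    [s l = s l ** cadj (s l) ** s l], a term with either range projection in the ideal is itself in
    the ideal. *)
Lemma core_span x : ckspan s (diagonal H) x -> exists G,
  [/\ uniq G, forall l, l \in G -> deg l = d,
    forall l, l \in G -> ~ ckspan s (diagonal H') (s l ** cadj (s l)) &
    lspan (leading_gen G `|` ckgen s (diagonal H')) x].
Proof.
elim => [|c a b [l [m [lm [dlm lH] aE]]] _ [G [G_uniq G_deg G_good Gb]]].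
  by exists [::]; split=> //; exact: lspan0.
have lg : ckspan s (diagonal H) (s l ** cadj (s m)) by exact: ckspan_gen.
have absorbed : ckspan s (diagonal H') a -> exists G,
  [/\ uniq G, forall l, l \in G -> deg l = d,
    forall l, l \in G -> ~ ckspan s (diagonal H') (s l ** cadj (s l)) &
    lspan (leading_gen G `|` ckgen s (diagonal H')) (c *: a + b)].
  move=> aH'; exists G; split=> //; apply: lspanD => //; apply: lspanZ.
  by apply: lspan_sub aH' => ? ?; apply: lspan_gen; right.
have [lH'|lH'] := boolP (deg l \in H').
  by apply: absorbed; rewrite aE; apply: ckspan_gen.
have ld : deg l = d by move: lH'; rewrite mem_filter lH andbT negbK => /eqP.
have [l_bad|l_good] := pselect (ckspan s (diagonal H') (s l ** cadj (s l))).
  apply: absorbed; rewrite aE -(CK_src sCK l) -(CK_adj_self L_fa sCK l).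
  by rewrite cmulA -cmulA; exact: ideal_r.
have [m_bad|m_good] := pselect (ckspan s (diagonal H') (s m ** cadj (s m))).
  apply: absorbed; rewrite aE -(CK_src sCK l) lm -(CK_adj_self L_fa sCK m).
  by rewrite cmulA -cmulA; exact: ideal_l.
have G'E n : n \in undup [:: l, m & G] -> [\/ n = l, n = m | n \in G].
  rewrite mem_undup !inE => /or3P[/eqP|/eqP|]; [exact: Or31|exact: Or32|exact: Or33].
exists (undup [:: l, m & G]); split; first exact: undup_uniq.
- by move=> n /G'E[->|->|/G_deg//]; rewrite -?dlm.
- by move=> n /G'E[->|->|/G_good].
- apply: lspanD; first (apply/lspanZ/lspan_gen; left; exists l, m).
    by rewrite !mem_undup !inE !eqxx orbT aE.
  apply: lspan_sub Gb => g [[n [p [nG pG np ->]]]|?]; apply: lspan_gen; last by right.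
  by left; exists n, p; rewrite !mem_undup !inE nG pG !orbT.
Qed.

End MinimalDegree.

(** An element of least total degree works: anything below it coordinatewise with no smaller sum is
    equal to it. *)
Lemma exists_minimal H : H != [::] ->
  exists2 d, d \in H & forall n, n \in H -> deg_join d n = d -> n = d.
Proof.
pose w (d : {ffun 'I_k -> nat}) := (\sum_i d i)%N.
move=> H0; have : exists e, has (fun d => w d == e) H.
  by case: H H0 => // d H _; exists (w d); rewrite /= eqxx.
move=> /ex_minnP[e /hasP[d dH /eqP we] e_min]; exists d => // n nH dn.
have nd i : (n i <= d i)%N.
  by move/ffunP: dn => /(_ i); rewrite ffunE => <-; exact: leq_maxr.
have := leqif_sum (fun i (_ : true) => leqif_eq (nd i)) => /leqifP.
case: ifP => [/forallP nd_eq _|_]; first by apply/ffunP => i; apply/eqP/nd_eq.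
by rewrite ltnNge -/(w n) -/(w d) we e_min //; apply/hasP; exists n.
Qed.

Lemma pi_isometric_diagonal H x : join_closed H -> ckspan s (diagonal H) x ->
  nrm x <= nrm (pi x).
Proof.
have [n] := ubnP (size H); elim: n H x => // n ih H x; rewrite ltnS => Hn Hjoin.
have [->|H0] := eqVneq H [::].
  elim => [|c a b [l [m [_ [_]]]]]; first by rewrite nrm0 nrm_ge0.
  by rewrite in_nil.
have [d dH d_min] := exists_minimal H0.
move=> /(core_span Hjoin d_min)[G [G_uniq G_deg G_good]].
move=> Gx; apply: (core_step Hjoin dH d_min G_uniq G_deg G_good _ Gx) => y; apply: ih; last exact: join_closed_H'.
apply: leq_trans Hn; rewrite size_filter -(count_predC (pred1 d) H).
by rewrite -[X in (X < _)%N]add0n ltn_add2r -has_count has_pred1.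
Qed.

Lemma pi_isometric_core x : ckspan s (fun a b => a = b) x -> nrm x <= nrm (pi x).
Proof.
move=> xs.
(* Boxes are join-closed and exhaust all degrees, so every element of the core lies over one of
   them. *)
pose box M := [seq ([ffun i => val (g i)] : {ffun 'I_k -> nat}) | g : {ffun 'I_k -> 'I_M}].
have boxP M (a : {ffun 'I_k -> nat}) : reflect (forall i, (a i < M)%N) (a \in box M).
  rewrite /box; apply: (iffP mapP) => [[g _ ->] i|aM]; first by rewrite ffunE ltn_ord.
  exists [ffun i => Ordinal (aM i)]; first by rewrite mem_enum.
  by apply/ffunP => i; rewrite !ffunE.
suff [M] : exists M, ckspan s (diagonal (box M)) x.
  apply: pi_isometric_diagonal => a b /boxP aM /boxP bM; apply/boxP => i.
  by rewrite ffunE gtn_max aM bM.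
elim: xs => [|c a b [l [m [lm dlm ->]]] _ [M bM]]; first by exists 0; exact: lspan0.
pose M' := (M + (\sum_i deg l i).+1)%N; exists M'.
apply: lspan_cons.
  exists l, m; split=> //; split=> //; apply/boxP => i.
  by rewrite /M' (bigD1 i) //=; lia.
apply: ckspan_sub bM => a' b' [<- /boxP aM]; split=> //; apply/boxP => i.
by have := aM i; rewrite /M'; lia.
Qed.

End Core.

(** * Averages over roots of unity *)

(** As [n] is nonzero in [C], the polynomial [X^n - 1] is separable; its [n] distinct roots must
    include a primitive one. *)
Lemma exists_prim_root (C : closedFieldType) n :
  (n%:R != 0 :> C) -> exists z : C, n.-primitive_root z.
Proof.
move=> n0; have n_gt0 : (0 < n)%N by case: n n0 => //; rewrite eqxx.
pose p : {poly C} := 'X^n - 1; have [r pE] := closed_field_poly_normal p.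
rewrite (monicP _) ?monicXnsubC // scale1r in pE.
have r_root : all n.-unity_root r.
  by apply/allP => z; rewrite -root_prod_XsubC -pE.
have r_size : (n < (size r).+1)%N.
  by rewrite -(size_prod_XsubC r id) -pE size_XnsubC.
have [|z] := hasP (has_prim_root n_gt0 r_root _ r_size); last by exists z.
by rewrite -separable_prod_XsubC -pE separable_Xn_sub_1.
Qed.

Lemma residue_unique (k N : nat) (a b : {ffun 'I_k -> nat}) : (0 < N)%N ->
  exists j0 : {ffun 'I_k -> 'I_N}, forall j : {ffun 'I_k -> 'I_N},
  [forall i, a i == b i + j i %[mod N]] = (j == j0).
Proof.
move=> N_gt0.
(* The residue of [a i - b i], with [b i] reduced first so that the truncated subtraction is
   exact. *)
pose r i := ((a i + (N - b i %% N)) %% N)%N.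
have rN i : (r i < N)%N by rewrite ltn_mod.
have rE i : a i = b i + r i %[mod N].
  rewrite modnDmr {1}(divn_eq (b i) N).
  have bN : (b i %% N <= N)%N by rewrite ltnW // ltn_mod.
  have -> : (b i %/ N * N + b i %% N + (a i + (N - b i %% N)) =
     (b i %/ N).+1 * N + a i)%N by rewrite mulSn; lia.
  by rewrite modnMDl.
exists [ffun i => Ordinal (rN i)] => j; apply/forallP/eqP => [h|-> i].
  apply/ffunP => i; apply/val_inj; rewrite ffunE /=.
  have := h i; rewrite rE eqn_modDl => /eqP.
  by rewrite (modn_small (rN i)) modn_small // => ->.
by rewrite ffunE /= -rE.
Qed.

Section Averaging.
Variables (R : realType) (k N : nat) (w : R[i]).
Hypothesis w_prim : N.-primitive_root w.
Implicit Types (f j : {ffun 'I_k -> 'I_N}) (a b : {ffun 'I_k -> nat}).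

Let N_gt0 : (0 < N)%N. Proof. exact: prim_order_gt0 w_prim. Qed.

Let w_norm : `|w| = 1.
Proof.
by apply/eqP; rewrite -(@pexpr_eq1 _ _ N) // -normrX (prim_expr_order w_prim) normr1.
Qed.

Let w_conj n : w ^+ n * (w ^+ n)^* = 1.
Proof. by rewrite -normCK normrX w_norm !expr1n. Qed.

Definition root_point f : 'rV[Cplx R]_k := \row_i (w ^+ f i).

(** The conjugate of the [j]-th character of [(Z/N)^k] at [f], used as a Fourier weight. *)
Definition root_char j f : R[i] := \prod_i (w ^+ (f i * j i))^*.

Lemma root_point_torus f : torus (root_point f).
Proof. by move=> i; rewrite mxE normrX w_norm expr1n. Qed.

Lemma root_char_norm j f : `|root_char j f| = 1.
Proof.
by rewrite /root_char normr_prod big1 // => i _; rewrite norm_conjC normrX w_norm expr1n.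
Qed.

(** A geometric sum in the [N]-th root of unity [u = w^(m - n)]: every term is 1 if [u = 1], and
    otherwise [(u - 1)] times the sum is [u^N - 1 = 0]. *)
Lemma root_sum m n : N%:R^-1 * \sum_(c < N) w ^+ (c * m) * (w ^+ (c * n))^* =
  (m == n %[mod N])%:R.
Proof.
pose u := w ^+ m * (w ^+ n)^*.
have uX (c : nat) : w ^+ (c * m) * (w ^+ (c * n))^* = u ^+ c.
  by rewrite !(mulnC c) !exprM rmorphXn -exprMn.
under eq_bigr do rewrite uX.
have N0 : (N%:R : R[i]) != 0 by rewrite pnatr_eq0 -lt0n.
have [mn|mn] := boolP (m == n %[mod N]).
  have -> : u = 1 by rewrite /u; move: mn; rewrite -(eq_prim_root_expr w_prim) => /eqP ->.
  under eq_bigr do rewrite expr1n.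
  by rewrite sumr_const card_ord mulVf.
have u1 : u - 1 != 0.
  rewrite subr_eq0; apply: contra mn => /eqP u1; rewrite -(eq_prim_root_expr w_prim).
  by rewrite -[w ^+ m]mulr1 -(w_conj n) mulrCA -/u u1 mulr1.
rewrite [X in _ * X](_ : _ = 0) ?mulr0 //; apply: (mulfI u1).
rewrite mulr0 -subrX1 /u exprMn -rmorphXn -!exprM !(mulnC _ N) !exprM.
by rewrite (prim_expr_order w_prim) !expr1n rmorph1 mulr1 subrr.
Qed.

Lemma root_orthogonality a b j :
  (N%:R ^+ k)^-1 * \sum_f root_char j f *
    (torus_exp (root_point f) a * (torus_exp (root_point f) b)^*) =
  [forall i, a i == b i + j i %[mod N]]%:R.
Proof.
have -> : [forall i, a i == b i + j i %[mod N]]%:R =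
    \prod_i (a i == b i + j i %[mod N])%:R :> R[i].
  case: forallP => [h|/forallP]; first by rewrite big1 // => i _; rewrite h.
  by rewrite negb_forall => /existsP[i /negPf ni]; rewrite (bigD1 i) //= ni mul0r.
under eq_bigr do rewrite -root_sum.
rewrite big_split /= prodr_const card_ord exprVn; congr (_ * _).
rewrite bigA_distr_bigA /=; apply: eq_bigr => f _.
rewrite /root_char /torus_exp rmorph_prod -!big_split /=; apply: eq_bigr => i _.
rewrite !mxE -!exprM mulnDr exprD rmorphM mulrC -mulrA.
by [].
Qed.

End Averaging.

(** * The gauge action *)

Section Density.
Variables (R : realType) (A : cstarType R).

Lemma cstar_generated_subalgebra (X : set A) : cstar_subalgebra (cstar_generated X).
Proof.
split; last by apply: closed_bigI => D [[_ cD] _].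
split=> [D [[[? _ _ _] _] _]|c a b Da Db D DX|a b Da Db D DX|a Da D DX] //.
- by case: (DX) => -[[_ lin _ _] _] _; apply: lin; [exact: Da|exact: Db].
- by case: (DX) => -[[_ _ M _] _] _; apply: M; [exact: Da|exact: Db].
- by case: (DX) => -[[_ _ _ adj] _] _; apply: adj; exact: Da.
Qed.

Lemma sub_cstar_generated (X : set A) : X `<=` cstar_generated X.
Proof. by move=> a Xa D [_ XD]; exact: XD. Qed.

(** The norm closure [cl] of [S] is a C*-subalgebra containing [X], hence is everything. *)
Lemma star_subalgebra_dense (S X : set A) : star_subalgebra S -> X `<=` S ->
  cstar_generated X = setT ->
  forall a (e : R), 0 < e -> exists2 x, S x & nrm (a - x) < e.
Proof.
move=> [S0 Slin SM Sadj] XS Xgen.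
pose cl : set A := [set a | forall e : R, 0 < e -> exists2 x, S x & nrm (a - x) < e].
have SE x : S x -> cl x by move=> Sx e e0; exists x => //; rewrite subrr nrm0.
suff cl_sub : cstar_subalgebra cl.
  move=> a; have : cstar_generated X a by rewrite Xgen.
  by move=> /(_ cl); apply; split => // x Xx; exact/SE/XS.
split; last first.
  apply: closed_nrm => a h e e0.
  have e2 : 0 < e / 2 by rewrite divr_gt0.
  have [x xcl ax] := h _ e2; have [y Sy xy] := xcl _ e2; exists y => //.
  have -> : a - y = (a - x) + (x - y) by rewrite addrA subrK.
  by apply: (le_lt_trans (nrmD _ _)); lra.
(* Errors up to [K * e] suffice, and only for [e <= 1]; the latter bounds the approximant [y] by
   [nrm b + 1] in the case of products. *)
have clK (K : R) a : 0 <= K ->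
    (forall e, 0 < e -> e <= 1 -> exists2 x, S x & nrm (a - x) <= K * e) -> cl a.
  move=> K0 h e e0; pose d := Num.min 1 (e / (K + 1) / 2).
  have K1 : 0 < K + 1 by rewrite ltr_wpDl.
  have d0 : 0 < d by rewrite lt_min ltr01 !divr_gt0.
  have [|x Sx ax] := h d d0; first by rewrite ge_min lexx.
  exists x => //; apply: (le_lt_trans ax).
  have : d <= e / (K + 1) / 2 by rewrite ge_min lexx orbT.
  rewrite ler_pdivlMr // ler_pdivlMr // => de; nra.
split.
- exact: SE.
- move=> c a b cla clb; pose M := complex.Re `|c|.
  have M0 : 0 <= M by rewrite -ler0c RRe_real ?ger0_real.
  apply: (clK (M + 1)) => [|e e0 _]; first lra.
  have [x Sx ax] := cla e e0; have [y Sy byE] := clb e e0.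
  exists (c *: x + y); first exact: Slin.
  rewrite opprD addrACA -scalerBr; apply: (le_trans (nrmD _ _)); rewrite nrmZ -/M.
  by have := nrm_ge0 (a - x); nra.
- move=> a b cla clb; have a0 := nrm_ge0 a; have b0 := nrm_ge0 b.
  apply: (clK (nrm a + nrm b + 1)) => [|e e0 e1]; first lra.
  have [x Sx ax] := cla e e0; have [y Sy byE] := clb e e0.
  exists (x ** y); first exact: SM.
  have -> : a ** b - x ** y = a ** (b - y) + (a - x) ** y.
    by rewrite cmulBr cmulBl addrA subrK.
  apply: (le_trans (nrmD _ _)).
  have := nrmM a (b - y); have := nrmM (a - x) y.
  have : nrm y <= nrm b + e.
    have := nrmD (y - b) b; rewrite subrK nrmB_sym; lra.
  have := nrm_ge0 y; have := nrm_ge0 (a - x); have := nrm_ge0 (b - y); nra.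
- move=> a cla e e0; have [x Sx ax] := cla e e0; exists (cadj x); first exact: Sadj.
  by rewrite -cadjN -cadjD nrm_cadj.
Qed.

End Density.

(** * Spectral components and injectivity *)

Section Gauge.
Variables (R : realType) (k : nat) (L : kgraph k) (L_fa : finitely_aligned L).
Variables (A : cstarType R) (s : L -> A) (sCK : CK_family s).
Variables (gamma : 'rV[Cplx R]_k -> A -> A) (gammaP : is_gauge_action s gamma).
Variables (B : cstarType R) (pi : A -> B) (pi_hom : star_hom pi).
Variable theta : 'rV[Cplx R]_k -> B -> B.
Hypothesis theta_action : strongly_continuous_action
  (cstar_generated (range (fun l => pi (s l)))) theta.
Hypothesis theta_pi : forall z, torus z -> forall a, theta z (pi a) = pi (gamma z a).
Hypothesis pi_vertex : forall v : vertex L, pi (s (ide v)) <> 0.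

Lemma gamma_hom z : torus z -> star_hom (gamma z).
Proof. by move=> zT; case: (action_aut gammaP.1 zT). Qed.

Lemma gamma_gen z l m : torus z -> gamma z (s l ** cadj (s m)) =
  (torus_exp z (deg l) * (torus_exp z (deg m))^*) *: (s l ** cadj (s m)).
Proof.
move=> zT; rewrite (star_homM (gamma_hom zT)) // (star_hom_cadj (gamma_hom zT)) //.
by rewrite !gammaP.2 // cadjZ cmulZl cmulZr scalerA.
Qed.

(** The coordinates of [a - b] lie in [[-K, K]]; two additive inequalities avoid truncated
    subtraction. *)
Definition band (K : nat) (a b : {ffun 'I_k -> nat}) : Prop :=
  forall i, (a i <= b i + K)%N /\ (b i <= a i + K)%N.

(** For [x] in the span, [pi x] lies in the subalgebra on which [theta z] is a homomorphism, hence
    contractive. *)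
Lemma nrm_theta z x : torus z -> ckspan s (fun _ _ => True) x ->
  nrm (theta z (pi x)) <= nrm (pi x).
Proof.
move=> zT xs; have cD := cstar_generated_subalgebra (range (fun l => pi (s l))).
apply: (star_hom_contractive cD (action_aut theta_action zT).1).
have [_ lin mul adj] := cD.1.
have gD l : cstar_generated (range (fun l => pi (s l))) (pi (s l)).
  by apply: sub_cstar_generated; exists l.
elim: xs => [|c a b [l [m [_ _ ->]]] _ ih].
  by rewrite (hom0 pi_hom); exact: star_subalgebra0 cD.1.
rewrite (star_hom_lin pi_hom) // (star_homM pi_hom) // (star_hom_cadj pi_hom) //.
by apply: lin => //; apply: mul => //; exact: adj.
Qed.

Section Components.
Variables (K : nat) (w : R[i]).
(** The [2K + 1] integers of [[-K, K]] are distinct modulo [N], so residues separate the degree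
    differences in a band. *)
Let N := (2 * K).+1.
Hypothesis w_prim : N.-primitive_root w.

(** A finite Fourier average over roots of unity in place of an integral over the torus: it projects
    onto the terms whose degree difference is [j] modulo [N]. *)
Definition component (j : {ffun 'I_k -> 'I_N}) (x : A) : A :=
  (N%:R ^+ k)^-1 *: \sum_(f : {ffun 'I_k -> 'I_N}) root_char w j f *: gamma (root_point w f) x.

Let rootT (f : {ffun 'I_k -> 'I_N}) : torus (root_point w f). Proof. exact: root_point_torus. Qed.

Lemma component_lin j c x y :
  component j (c *: x + y) = c *: component j x + component j y.
Proof.
rewrite /component scalerA mulrC -scalerA -scalerDr; congr (_ *: _).
rewrite scaler_sumr -big_split /=; apply: eq_bigr => f _.
by rewrite (star_hom_lin (gamma_hom (rootT f))) // scalerDr !scalerA mulrC.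
Qed.

Lemma component_gen j l m : component j (s l ** cadj (s m)) =
  [forall i, deg l i == deg m i + j i %[mod N]]%:R *: (s l ** cadj (s m)).
Proof.
rewrite -(root_orthogonality w_prim) -scalerA scaler_suml; congr (_ *: _).
by apply: eq_bigr => f _; rewrite gamma_gen // scalerA.
Qed.

Lemma component0 j : component j 0 = 0.
Proof.
rewrite /component big1 ?scaler0 // => f _.
by rewrite (hom0 (gamma_hom (rootT f))) scaler0.
Qed.

Definition residue (j : {ffun 'I_k -> 'I_N}) (a b : {ffun 'I_k -> nat}) : Prop :=
  band K a b /\ forall i, a i == b i + j i %[mod N].

Lemma component_span j x : ckspan s (band K) x -> ckspan s (residue j) (component j x).
Proof.
elim => [|c a b [l [m [lm Klm ->]]] _ ih]; first by rewrite component0; exact: lspan0.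
rewrite component_lin component_gen; apply: lspanD => //; apply: lspanZ.
case: forallP => jlm; last by rewrite scale0r; exact: lspan0.
by rewrite scale1r; exact: ckspan_gen.
Qed.

Lemma component_sum x : ckspan s (band K) x -> x = \sum_j component j x.
Proof.
elim => [|c a b [l [m [lm Klm ->]]] _ ih].
  by rewrite big1 // => j _; exact: component0.
under eq_bigr do rewrite component_lin component_gen.
rewrite big_split /= -ih -scaler_sumr; congr (_ *: _ + _).
have [j0 j0E] := residue_unique (deg l) (deg m) (ltn0Sn (2 * K)).
rewrite (bigD1 j0) //= j0E eqxx scale1r big1 ?addr0 // => j /negPf jj0.
by rewrite j0E jj0 scale0r.
Qed.

(** [pi] turns each [gamma z x] into [theta z (pi x)], so the image is an average of [N^k] elements
    of norm at most [|pi x|]. *)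
Lemma nrm_pi_component j x : ckspan s (band K) x ->
  nrm (pi (component j x)) <= nrm (pi x).
Proof.
move=> xs; have xs' : ckspan s (fun _ _ => True) x by apply: ckspan_sub xs.
have pi_sum (F : {ffun 'I_k -> 'I_N} -> A) : pi (\sum_f F f) = \sum_f pi (F f).
  by apply: (big_morph pi (homD pi_hom) (hom0 pi_hom)).
rewrite /component (homZ pi_hom) pi_sum nrmZ -natrX Re_norm_invn mulrC ler_pdivrMr; last first.
  by rewrite ltr0n expn_gt0.
apply: (le_trans (nrm_sum _ _ _)).
have -> : nrm (pi x) * (N ^ k)%:R = \sum_(f : {ffun 'I_k -> 'I_N}) nrm (pi x).
  by rewrite sumr_const card_ffun !card_ord mulr_natr.
apply: ler_sum => f _; rewrite (homZ pi_hom) nrmZ (root_char_norm w_prim) // mul1r.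
by rewrite -theta_pi //; exact: nrm_theta.
Qed.

(** All terms of [y = component j x] have the same degree difference, which cancels in
    [cadj y ** y]; that product is therefore in the core. *)
Lemma nrm_component j x : ckspan s (band K) x ->
  nrm (component j x) <= nrm (pi (component j x)).
Proof.
move=> /(component_span j); set y := component j x => ys.
apply: (nrm_le_of_cadjM pi_hom).
apply: (pi_isometric_core L_fa sCK pi_hom pi_vertex).
have ys' : ckspan s (fun a b => residue j b a) (cadj y) by apply: ckspan_cadj ys.
apply: (ckspanM L_fa sCK) ys' ys => a b c d u v [Kba ba] [Kcd cd] bu cv.
apply/ffunP => i; rewrite !ffunE; change (a i + u i = d i + v i)%N.
have {bu}bu : (b i + u i = maxn (b i) (c i))%N by move/ffunP: bu => /(_ i); rewrite !ffunE.
have {cv}cv : (c i + v i = maxn (b i) (c i))%N by move/ffunP: cv => /(_ i); rewrite !ffunE.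
have [Kba1 Kba2] := Kba i; have [Kcd1 Kcd2] := Kcd i.
have : a i + u i == d i + v i %[mod N].
  rewrite -(eqn_modDr (j i)) addnAC -modnDml -(eqP (ba i)) modnDml bu -cv.
  by rewrite -modnDml (eqP (cd i)) modnDml addnAC.
(* Two congruent degrees at distance at most [2K < N] coincide. *)
have close m n : (m <= n)%N -> (n <= m + 2 * K)%N -> m == n %[mod N] -> m = n.
  move=> mn nm; rewrite eq_sym eqn_mod_dvd // => dv.
  have : (n - m < N)%N by rewrite /N; lia.
  by move=> lt; move: dv; rewrite /dvdn modn_small // => /eqP; lia.
case: (leqP (a i + u i) (d i + v i)) => le e; first by apply: close => //; lia.
by apply/esym; apply: close; rewrite 1?eq_sym // ?(ltnW le) //; lia.
Qed.

Lemma nrm_le_band x : ckspan s (band K) x -> nrm x <= (N ^ k)%:R * nrm (pi x).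
Proof.
move=> xs; rewrite {1}(component_sum xs); apply: (le_trans (nrm_sum _ _ _)).
have -> : (N ^ k)%:R * nrm (pi x) = \sum_(f : {ffun 'I_k -> 'I_N}) nrm (pi x).
  by rewrite sumr_const card_ffun !card_ord mulr_natl.
by apply: ler_sum => j _; apply: le_trans (nrm_component j xs) (nrm_pi_component j xs).
Qed.

End Components.

Lemma band_mul K K' x y : ckspan s (band K) x -> ckspan s (band K') y ->
  ckspan s (band (K + K')) (x ** y).
Proof.
apply: (ckspanM L_fa sCK) => a b c d u v ab cd bu cv i.
have {}bu : (b i + u i = maxn (b i) (c i))%N by move/ffunP: bu => /(_ i); rewrite !ffunE.
have {}cv : (c i + v i = maxn (b i) (c i))%N by move/ffunP: cv => /(_ i); rewrite !ffunE.
by have [? ?] := ab i; have [? ?] := cd i; rewrite !ffunE;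
  change (a i + u i <= d i + v i + (K + K') /\ d i + v i <= a i + u i + (K + K'))%N; lia.
Qed.

Lemma pi_isometric_span x : ckspan s (fun _ _ => True) x -> nrm x <= nrm (pi x).
Proof.
move=> xs.
have [K xK] : exists K, ckspan s (band K) x.
  elim: xs => [|c a b [l [m [lm _ ->]]] _ [K bK]]; first by exists 0; exact: lspan0.
  exists (K + (\sum_i deg l i + \sum_i deg m i))%N; apply: lspan_cons.
    exists l, m; split=> // i.
    have le_sum (d : {ffun 'I_k -> nat}) : (d i <= \sum_i d i)%N.
      by rewrite (bigD1 i) //= leq_addr.
    by have := le_sum (deg l); have := le_sum (deg m); lia.
  by apply: ckspan_sub bK => a' b' + i => /(_ i)[]; lia.
apply: (nrm_le_of_cadjM pi_hom); pose q : R := (2 ^ k)%:R.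
(* [cadj x ** x] has band width [2K], and each squaring doubles the width. *)
pose P j := ckspan s (band ((K + K) * 2 ^ j)).
apply: (@nrm_le_of_growth _ _ _ _ pi_hom P ((4 * K).+1 ^ k)%:R q).
- by rewrite ler1n expn_gt0.
- rewrite /P muln1; apply: band_mul => //; apply: ckspan_cadj xK => a b ab i.
  by case: (ab i).
- by rewrite cadjM cadjK.
- by move=> j y Py; rewrite /P expnS mulnCA mul2n -addnn; exact: band_mul.
move=> j y Py; set K' := ((K + K) * 2 ^ j)%N in Py.
have N0 : ((2 * K').+1)%:R != 0 :> R[i] by rewrite pnatr_eq0.
have [w w_prim] := exists_prim_root N0.
apply: le_trans (nrm_le_band w_prim Py) _; apply: ler_wpM2r; first exact: nrm_ge0.
(* With [K' = 2K * 2^j], the number of components is [(2K' + 1)^k <= ((4K + 1) * 2^j)^k = (4K + 1)^k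
   * q^j]. *)
rewrite /q -natrX -natrM ler_nat -expnM [(k * j)%N]mulnC expnM -expnMn.
have pow_mono e m n : (m <= n)%N -> (m ^ e <= n ^ e)%N.
  by case: e => // e; rewrite leq_exp2r.
apply: pow_mono; have : (0 < 2 ^ j)%N by rewrite expn_gt0.
rewrite /K'; nia.
Qed.

(** If [pi a = pi b] and [x] in the span is close to [a - b], then [|x| <= |pi x| = |pi (a - b - x)|
    <= |a - b - x|], so [|a - b|] is at most twice the error. *)
Lemma gauge_equivariant_injective : cstar_generated (range s) = setT -> injective pi.
Proof.
move=> s_gen a b piab; apply: (@nrm_le_eq _ _ _ _ 2) => // e e0.
have S_sub : star_subalgebra (ckspan s (fun _ _ => True)).
  split; first exact: lspan0.
  - by move=> c x y xs ys; apply: lspanD => //; exact: lspanZ.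
  - by move=> x y; apply: (ckspanM L_fa sCK).
  - by move=> x; exact: ckspan_cadj.
have gen_sub : range s `<=` ckspan s (fun _ _ => True).
  (* A generator becomes a spanning term by writing it as [s l ** cadj (s (ide (src l)))]. *)
  move=> _ [l _ <-]; rewrite -(CK_src sCK l).
  rewrite -(CK_projection sCK (src l)).1; apply: ckspan_gen => //.
  by rewrite src_ide.
have [x xs abx] := star_subalgebra_dense S_sub gen_sub
  s_gen (a - b) e0.
have x_le : nrm x <= nrm (a - b - x).
  apply: (le_trans (pi_isometric_span xs)); rewrite -[leLHS]nrmN.
  have -> : - pi x = pi (a - b - x); last exact: (hom_contractive pi_hom).
  by rewrite !(homD pi_hom) !(homN pi_hom) piab subrr add0r.
have := nrmD (a - b - x) x; rewrite subrK; lra.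
Qed.

End Gauge.

Theorem theorem4p2 (R : realType) (k : nat) (L : kgraph k)
  (L_fa : finitely_aligned L)
  (A : cstarType R) (s : L -> A) (s_univ : is_graph_algebra s)
  (gamma : 'rV[Cplx R]_k -> A -> A) (gamma_gauge : is_gauge_action s gamma)
  (B : cstarType R) (pi : A -> B) (pi_hom : star_hom pi)
  (theta : 'rV[Cplx R]_k -> B -> B)
  (theta_action : strongly_continuous_action
     (cstar_generated (range (fun l => pi (s l)))) theta)
  (theta_pi : forall z, torus z -> forall a, theta z (pi a) = pi (gamma z a))
  (pi_vertex : forall v : vertex L, pi (s (ide v)) <> 0) :
  injective pi.
Proof.
have [s_CK s_gen _] := s_univ.
exact: (gauge_equivariant_injective L_fa s_CK gamma_gauge pi_hom theta_action
  theta_pi pi_vertex s_gen).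
Qed.
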